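(* Let $I\subset\mathbf{\Delta}$, let $\mathbf{L}=\mathbf{L}_I$ be the corresponding standard Levi subgroup of $\mathbf{GL}_n$, and let $w\in\mathbf{S}_n^d$ be an arbitrary non-identity Grassmann permutation, written in one-line notation as $$w=(a_1\; a_1+1\,\dots\, a_1+b_1\;\; a_2\; a_2+1\,\dots\, a_2+b_2\;\dots\; a_j\; a_j+1\,\dots\, a_j+b_j\;\; w_{d+1}\dots w_n),$$ where $a_\ell+b_\ell+1<a_{\ell+1}$ for $1\leq\ell<j$. Assume that the Schubert variety $X_{w\mathbf{Q}_d}\subseteq\mathbf{GL}_n/\mathbf{Q}_d$ is $\mathbf{L}$-stable. Then any Schubert divisor of $X_{w\mathbf{Q}_d}$ is of the form $X_{w_\ell\mathbf{Q}_d}$ for some $1\leq\ell\leq j$ (with $a_\ell>1$). Furthermore, the Schubert divisor $X_{w_\ell\mathbf{Q}_d}$ is $\mathbf{L}$-stable (equivalently, $w_\ell$ is a degree 1 head for $w$) if and only if $\mathbf{\Delta}\setminus I$ contains $a_\ell-1$.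
   Context: Work over $\mathbb{C}$. $\mathbf{B}_n$ and $\mathbf{T}_n$ are the upper triangular matrices and the diagonal torus in $\mathbf{GL}_n$, and $\mathbf{\Delta}=\{\alpha_1,\dots,\alpha_{n-1}\}$ is the corresponding set of simple roots in standard order; subsets of $\mathbf{\Delta}$ are identified with sets of indices in $\{1,\dots,n-1\}$. For $I\subset\mathbf{\Delta}$, $\mathbf{L}_I\supset\mathbf{T}_n$ is the standard Levi factor of the standard parabolic subgroup (containing $\mathbf{B}_n$) whose simple roots are $I$. $\mathbf{Q}_d$ is the standard maximal parabolic subgroup corresponding to $\mathbf{\Delta}\setminus\{\alpha_d\}$, so $\mathbf{GL}_n/\mathbf{Q}_d\cong\mathbf{Gr}(d,n)$. $\mathbf{S}_n^d$ is the set of permutations $w=(w_1\dots w_n)$ (one-line notation) of $\{1,\dots,n\}$ with $w_1<\dots<w_d$ and $w_{d+1}<\dots<w_n$. $X_{w\mathbf{Q}_d}$ is the Zariski closure of $\mathbf{B}_nw\mathbf{Q}_d/\mathbf{Q}_d$; a Schubert divisor of it is a Schubert subvariety of codimension one. In the displayed notation, the first $d$ entries of $w$ are grouped into maximal runs of consecutive integers with $b_\ell\geq 0$. For $1\leq\ell\leq j$ with $a_\ell>1$, $w_\ell\in\mathbf{S}_n^d$ is the permutation obtained from $w$ by replacing the entry $a_\ell$ among the first $d$ entries by $a_\ell-1$ (i.e. exchanging the values $a_\ell-1$ and $a_\ell$). Groups act by left multiplication. An element $\theta\in\mathbf{S}_n^d$ with $X_{\theta\mathbf{Q}_d}\subseteq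 X_{w\mathbf{Q}_d}$ is a degree 1 head for $w$ (with respect to $\mathbf{L}$) if $X_{\theta\mathbf{Q}_d}$ is $\mathbf{L}$-stable. *)

(* Defs.v *)
From mathcomp Require Import all_boot all_order all_algebra all_fingroup.
From mathcomp Require Import boolp classical_sets reals complex.
From mathcomp Require mpoly.

Set Implicit Arguments.
Unset Strict Implicit.
Unset Printing Implicit Defensive.

Import GRing.Theory.

Local Open Scope classical_set_scope.
Local Open Scope ring_scope.

(* Conventions.  Rows, columns and permuted points are indexed by 'I_n, hence
   from 0, whereas simple roots, one-line notation and the numbers d, a_l, b_l
   are 1-based natural numbers.  The simple root alpha_k = e_k - e_(k+1)
   therefore separates the 0-based indices k-1 and k. *)

Definition simple_roots (n : nat) : set nat := [set k | (0 < k < n)%N].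

(* e_p - e_q (0-based, with p and q in either order) is an integer combination
   of the simple roots in I. *)
Definition in_root_span (I : set nat) (p q : nat) : Prop :=
  forall k, (minn p q < k <= maxn p q)%N -> I k.

Section GrassmannPermutations.
Variables (n d : nat).

Definition one_line (w : 'S_n) : seq nat := [seq (w i).+1 | i <- enum 'I_n].

Definition grassmann_perm (w : 'S_n) : Prop :=
  forall p q : 'I_n, (p < q)%N -> (q < d)%N || (d <= p)%N -> (w p < w q)%N.

(* Exchanges the (1-based) values c-1 and c in the one-line notation of w, for
   1 < c <= n.  MathComp's (s * t) i is t (s i), so right multiplication acts
   on values. *)
Definition exchange_below (w : 'S_n) (c : nat) : 'S_n :=
  match insub c.-2, insub c.-1 with
  | Some x, Some y => (w * tperm x y)%g
  | _, _ => w
  end.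

End GrassmannPermutations.

Section SchubertVarieties.
Variables (F : fieldType) (n : nat).

Definition GL : set 'M[F]_n := [set g | g \in unitmx].

Definition borel : set 'M[F]_n :=
  [set g | GL g /\ forall p q : 'I_n, (q < p)%N -> g p q = 0].

Definition parabolic (I : set nat) : set 'M[F]_n :=
  [set g | GL g /\
    forall p q : 'I_n, (q < p)%N -> ~ in_root_span I p q -> g p q = 0].

(* The intersection of the standard parabolic with its opposite. *)
Definition levi (I : set nat) : set 'M[F]_n :=
  [set g | parabolic I g /\ parabolic I g^T].

Definition max_parabolic (d : nat) : set 'M[F]_n :=
  parabolic (simple_roots n `\ d).

(* Polynomials in the n * n matrix entries suffice: multiplying a regular
   function by a power of det does not change its zeros in GL_n. *)
Definition GL_closed (Z : set 'M[F]_n) : Prop :=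
  exists S : set (mpoly.mpoly (n * n) F),
    Z = [set g | GL g /\
      forall p, S p -> mpoly.meval (fun k => mxvec g 0 k) p = 0].

(* A point of GL_n / Q_d is a left coset g Q_d, seen as a set of matrices. *)
Variable d : nat.

Definition lcosetQ (g : 'M[F]_n) : set 'M[F]_n :=
  [set g *m q | q in max_parabolic d].

Definition GLmodQ : set (set 'M[F]_n) := [set lcosetQ g | g in GL].

(* The Zariski topology of GL_n / Q_d is the quotient topology. *)
Definition GLmodQ_closed (Z : set (set 'M[F]_n)) : Prop :=
  Z `<=` GLmodQ /\ GL_closed [set g | GL g /\ Z (lcosetQ g)].

Definition zariski_closure (Y : set (set 'M[F]_n)) : set (set 'M[F]_n) :=
  \bigcap_(Z in [set Z | GLmodQ_closed Z /\ Y `<=` Z]) Z.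

(* perm_mx w^-1 is the matrix sending the j-th basis column to the (w j)-th. *)
Definition schubert_cell (w : 'S_n) : set (set 'M[F]_n) :=
  [set lcosetQ (b *m perm_mx (w^-1)%g) | b in borel].

Definition schubert (w : 'S_n) : set (set 'M[F]_n) :=
  zariski_closure (schubert_cell w).

Definition stable (H : set 'M[F]_n) (X : set (set 'M[F]_n)) : Prop :=
  forall g x, H g -> X x -> X [set g *m y | y in x].

Definition irreducible_closed (Z : set (set 'M[F]_n)) : Prop :=
  [/\ GLmodQ_closed Z, Z !=set0 &
    forall Z1 Z2, GLmodQ_closed Z1 -> GLmodQ_closed Z2 ->
      Z `<=` Z1 `|` Z2 -> Z `<=` Z1 \/ Z `<=` Z2].

Definition irreducible_chain (Z X : set (set 'M[F]_n)) (m : nat) : Prop :=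
  exists c : nat -> set (set 'M[F]_n),
    [/\ c 0%N = Z, c m `<=` X,
        forall i, (i <= m)%N -> irreducible_closed (c i) &
        forall i, (i < m)%N -> c i `<` c i.+1].

Definition has_codim (Z X : set (set 'M[F]_n)) (k : nat) : Prop :=
  irreducible_chain Z X k /\
  forall m, irreducible_chain Z X m -> (m <= k)%N.

Definition schubert_divisor (w : 'S_n) (D : set (set 'M[F]_n)) : Prop :=
  exists v : 'S_n, [/\ grassmann_perm d v, D = schubert v,
    D `<=` schubert w & has_codim D (schubert w) 1].

Definition degree1_head (I : set nat) (w theta : 'S_n) : Prop :=
  [/\ grassmann_perm d theta, schubert theta `<=` schubert w &
      stable (levi I) (schubert theta)].

End SchubertVarieties.

Arguments schubert F {n} d w.
Arguments schubert_divisor {F n} d w D.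
Arguments degree1_head F {n} d I w theta.
Arguments levi F n I : clear implicits.

(* Main.v *)
(* The coset g Q_d is controlled by the ranks r_i(g) of the rows >= i of the first
   d columns of g.  By Gaussian elimination, X_w consists of the cosets such that
   r_i(g) <= #{p < d | i <= w p} for all i: replacing an entry x of w by x - 1
   stays in the closure of the cell, and such moves generate the order on these
   rank functions.  So X_w is L_I-stable iff no k in I has k but not k + 1 among
   the first d entries of w, and every X_v strictly inside X_w lies in some X_{w_l}.

   It remains to see that no irreducible closed Z lies strictly between X_{w_l} and
   X_w.  Where the Pluecker coordinate delta of w_l does not vanish, X_{w_l} is cut
   out of X_w by the Pluecker coordinate tau of w.  A function f that vanishes on
   Z, but not on X_w, is of the form tau^K h there, with h not zero on X_{w_l}.
   Then Z is covered by X_{w_l} and the zeros of delta h, and contained in neither. *)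

Require Import Defs.
From mathcomp Require Import all_boot all_order all_algebra all_fingroup.
From mathcomp Require Import boolp classical_sets reals complex.
From mathcomp Require Import zify.
From mathcomp Require Import mpoly.

Set Implicit Arguments.
Unset Strict Implicit.
Unset Printing Implicit Defensive.

Import GRing.Theory Num.Theory.

Local Open Scope classical_set_scope.
Local Open Scope ring_scope.

(** * Ranks of trailing rows *)

Section CoordinateMasks.
Variables (R : comNzRingType) (n : nat).
Implicit Types (S T : pred 'I_n) (s : 'S_n).

(** A diagonal idempotent: rows or columns are zeroed instead of deleted, so truncated matrices keep
    their size. *)
Definition mask S : 'M[R]_n := \matrix_(i, j) ((i == j) && S i)%:R.

Lemma mask_mulE S m (A : 'M_(n, m)) i j :
  (mask S *m A) i j = if S i then A i j else 0.
Proof.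
rewrite mxE (bigD1 i) //= big1 ?addr0 => [|k ki]; rewrite mxE ?eqxx /=.
  by case: (S i); rewrite (mul1r, mul0r).
by rewrite eq_sym (negbTE ki) mul0r.
Qed.

Lemma tr_mask S : (mask S)^T = mask S.
Proof. by apply/matrixP => i j; rewrite !mxE eq_sym; case: eqP => // ->. Qed.

Lemma mul_maskE S m (A : 'M_(m, n)) i j :
  (A *m mask S) i j = if S j then A i j else 0.
Proof. by rewrite -[A *m _]trmxK trmx_mul mxE tr_mask mask_mulE mxE. Qed.

Lemma row_mask S m (A : 'M_(n, m)) i :
  row i (mask S *m A) = if S i then row i A else 0.
Proof. by apply/rowP => j; rewrite mxE mask_mulE; case: (S i); rewrite mxE. Qed.

Lemma mask_mul S T : mask S *m mask T = mask (predI S T).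
Proof.
apply/matrixP => i j; rewrite mask_mulE !mxE /= andbCA.
by case: (S i); rewrite ?andbF.
Qed.

Lemma mask_idem S : mask S *m mask S = mask S.
Proof. by rewrite mask_mul; apply/matrixP => i j; rewrite !mxE /= andbb. Qed.

Lemma mask_predT : mask predT = 1%:M.
Proof. by apply/matrixP => i j; rewrite !mxE andbT. Qed.

Lemma mask_compl S : mask (predC S) = 1%:M - mask S.
Proof.
apply/matrixP => i j; rewrite !mxE /=.
by case: (i == j); case: (S i); rewrite /= ?subrr ?subr0.
Qed.

Lemma perm_mulE s m (A : 'M[R]_(n, m)) i j : (perm_mx s *m A) i j = A (s i) j.
Proof. by rewrite -row_permE mxE. Qed.

Lemma mul_permE s m (A : 'M[R]_(m, n)) i j : (A *m perm_mx s^-1) i j = A i (s j).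
Proof. by rewrite -col_permE mxE. Qed.

Lemma perm_mxVE s i j : perm_mx s^-1 i j = (i == s j)%:R :> R.
Proof. by rewrite -[perm_mx _]mul1mx mul_permE mxE. Qed.

Lemma mask_perm s S : mask S *m perm_mx s^-1 = perm_mx s^-1 *m mask (S \o s).
Proof.
apply/matrixP => i j; rewrite mask_mulE mul_maskE perm_mxVE /=.
by case: eqP => [->|] //; rewrite !if_same.
Qed.

End CoordinateMasks.

Arguments mask {R n} S.

Section TailRank.
Variables (F : fieldType) (n : nat).

Definition tail (i : nat) : pred 'I_n := fun k => (i <= k)%N.
Definition head (d : nat) : pred 'I_n := fun k => (k < d)%N.

Definition tail_rank m i (A : 'M[F]_(n, m)) : nat := \rank (mask (tail i) *m A).

(** The pivot rows of Gaussian elimination run from the last row upwards. *)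
Definition jump m (A : 'M[F]_(n, m)) (k : 'I_n) : bool :=
  ~~ (row k A <= mask (tail k.+1) *m A)%MS.

Lemma row_sub_mask (S : pred 'I_n) m (A : 'M[F]_(n, m)) k :
  S k -> (row k A <= mask S *m A)%MS.
Proof. by move=> Sk; have := row_sub k (mask S *m A); rewrite row_mask Sk. Qed.

Lemma mask_subP (S : pred 'I_n) m p (A : 'M[F]_(n, m)) (B : 'M[F]_(p, m)) :
  reflect (forall k, S k -> (row k A <= B)%MS) (mask S *m A <= B)%MS.
Proof.
apply: (iffP row_subP) => H k; last first.
  by rewrite row_mask; case: ifP => [/H //|_]; rewrite sub0mx.
by move=> Sk; have := H k; rewrite row_mask Sk.
Qed.

Lemma mask_tail_step m (A : 'M[F]_(n, m)) (k : 'I_n) :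
  (mask (tail k) *m A :=: row k A + mask (tail k.+1) *m A)%MS.
Proof.
apply/eqmxP/andP; split.
  apply/mask_subP => i; rewrite /tail leq_eqVlt => /orP[/eqP/val_inj <-|ki].
    exact: addsmxSl.
  by apply: submx_trans (addsmxSr _ _); apply: row_sub_mask.
rewrite addsmx_sub row_sub_mask ?/(tail _ _) //=.
by apply/mask_subP => i ki; rewrite row_sub_mask // /tail ltnW.
Qed.

(** A row outside the span of the later rows meets that span trivially, so it raises the rank by
    exactly one. *)
Lemma tail_rank_step m (A : 'M[F]_(n, m)) (k : 'I_n) :
  tail_rank k A = (jump A k + tail_rank k.+1 A)%N.
Proof.
rewrite /tail_rank mask_tail_step /jump.
have [sub|nsub] /= := boolP (row k A <= _)%MS.
  by rewrite (addsmx_idPr sub).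
have := mxrank_sum_cap (row k A) (mask (tail k.+1) *m A).
have rk : \rank (row k A) = 1%N.
  apply/eqP; rewrite eqn_leq rank_leq_row lt0n mxrank_eq0.
  by apply: contra nsub => /eqP ->; rewrite sub0mx.
suff -> : \rank (row k A :&: mask (tail k.+1) *m A)%MS = 0%N by rewrite rk addn0.
apply/eqP; rewrite -leqn0 -ltnS -[ltnRHS]rk; apply: contraNltn nsub => le1.
apply: submx_trans (capmxSr (row k A) _).
by rewrite -(mxrank_leqif_sup (capmxSl _ _)) eqn_leq mxrankS ?capmxSl.
Qed.

Lemma tail_rank_ge m (A : 'M[F]_(n, m)) i : (n <= i)%N -> tail_rank i A = 0%N.
Proof.
move=> ni; apply/eqP; rewrite mxrank_eq0; apply/eqP/matrixP => p q.
by rewrite mask_mulE /tail leqNgt (leq_trans (ltn_ord p) ni) mxE.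
Qed.

Lemma tail_rank_jump m (A : 'M[F]_(n, m)) i :
  tail_rank i A = #|[pred k | tail i k && jump A k]|.
Proof.
have [ni|] := leqP n i.
  rewrite tail_rank_ge // eq_card0 // => k; rewrite !inE /tail.
  by rewrite leqNgt (leq_trans (ltn_ord k) ni).
move: {2}(n - i)%N (erefl (n - i)%N) => e; elim: e i => [|e IH] i ei lin; first by lia.
have -> : tail_rank i A = (jump A (Ordinal lin) + tail_rank i.+1 A)%N.
  exact: (tail_rank_step A (Ordinal lin)).
rewrite (cardD1 (Ordinal lin)) !inE /= {1}/tail leqnn /=; congr addn.
have -> : tail_rank i.+1 A = #|[pred k | tail i.+1 k && jump A k]|.
  have [ni|/IH] := leqP n i.+1; last by apply; lia.
  rewrite tail_rank_ge // eq_card0 // => k; rewrite !inE /tail.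
  by rewrite leqNgt (leq_trans (ltn_ord k) ni).
apply: eq_card => k; rewrite !inE /tail -val_eqE /=.
by rewrite ltn_neqAle eq_sym andbA.
Qed.

Lemma tail_rank_leS m (A : 'M[F]_(n, m)) i :
  (tail_rank i.+1 A <= tail_rank i A <= (tail_rank i.+1 A).+1)%N.
Proof.
have [ni|lin] := leqP n i; first by rewrite !tail_rank_ge // ltnW.
rewrite (tail_rank_step A (Ordinal lin)) /=.
by case: jump; rewrite /= ?add0n ?add1n leqnn ?leqnSn.
Qed.

Lemma rank_mask (S : pred 'I_n) : \rank (mask S : 'M[F]_n) = #|S|.
Proof.
transitivity (tail_rank 0 (mask S : 'M[F]_n)).
  rewrite /tail_rank (_ : mask (tail 0) = 1%:M) ?mul1mx //.
  exact: mask_predT.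
rewrite tail_rank_jump; apply: eq_card => k; rewrite !inE /=; rewrite /jump.
have [Sk|nSk] := boolP (S k); last first.
  suff -> : row k (mask S) = 0 :> 'rV[F]_n by rewrite sub0mx unfold_in (negbTE nSk).
  by apply/rowP => j; rewrite !mxE (negbTE nSk) andbF.
(* Column k vanishes on all rows below k, whereas row k of the mask has a one there. *)
rewrite unfold_in Sk; apply: contraT; rewrite negbK => /submxP[D /rowP /(_ k)].
rewrite mulmxA mul_maskE Sk mul_maskE /tail ltnn !mxE eqxx Sk => /eqP.
by rewrite oner_eq0.
Qed.

Lemma tail_rank_perm (w : 'S_n) d i :
  tail_rank i (perm_mx w^-1 *m mask (head d) : 'M[F]_n)
    = #|[pred p | head d p && tail i (w p)]|.
Proof.
rewrite /tail_rank mulmxA mask_perm -mulmxA mask_mul eqmxMfull ?rank_mask.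
  by apply: eq_card => p; rewrite !inE /= andbC.
by rewrite row_full_unit unitmx_perm.
Qed.

End TailRank.

(** * Cosets of the maximal parabolic *)

Section Cosets.
Variables (F : fieldType) (n d : nat).
Implicit Types (g h q : 'M[F]_n).
Local Notation E := (mask (@head n d)).
Local Notation Q := (@max_parabolic F n d).

(** By a rank comparison [mask S *m g] and [mask S] have the same row space, so [mask S] is a left
    multiple X of [mask S *m g]; cancelling g gives the shape of the inverse. *)
Lemma mask_block_inv (S : pred 'I_n) g : g \in unitmx ->
  mask S *m g = mask S *m g *m mask S ->
  mask S *m invmx g = mask S *m invmx g *m mask S.
Proof.
move=> gU gS; have /submxP[X SX] : ((mask S : 'M[F]_n) <= mask S *m g)%MS.
  have le : (mask S *m g <= mask S)%MS by rewrite gS submxMl.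
  by rewrite -(mxrank_leqif_sup le) mxrankMfree ?row_free_unit.
have -> : mask S *m invmx g = X *m mask S by rewrite {1}SX !mulmxA mulmxK.
by rewrite -mulmxA mask_idem.
Qed.

(** Only pairs of indices separated by d fall outside the root span, so Q_d is the stabiliser of the
    span of the first d basis vectors. *)
Lemma max_parabolicP g :
  Q g <-> GL g /\ g *m E = E *m g *m E.
Proof.
split=> -[gU H]; split=> //.
  apply/matrixP => i j; rewrite mul_maskE -mulmxA mask_mulE mul_maskE /head.
  case: ltnP => // jd; case: ltnP => // di.
  apply: H; first exact: leq_trans jd di.
  move=> /(_ d); rewrite (minn_idPr _) ?(maxn_idPl _) ?jd ?di; last 2 first.
  - exact: leq_trans (ltnW jd) di.
  - exact: leq_trans (ltnW jd) di.
  by case=> // _; apply.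
move=> p q qp nspan.
have [di jd] : (d <= p)%N /\ (q < d)%N.
  apply/andP; apply: contra_notT nspan => /nandP npq k.
  rewrite (minn_idPr (ltnW qp)) (maxn_idPl (ltnW qp)) => /andP[qk kp]; split.
    by rewrite /simple_roots /=; have := ltn_ord p; lia.
  by move=> /= kd; lia.
move/matrixP/(_ p q): H; rewrite mul_maskE -mulmxA mask_mulE /head jd.
by rewrite ltnNge di.
Qed.

Lemma max_parabolic1 : Q 1%:M.
Proof. by apply/max_parabolicP; rewrite /GL /= unitmx1 mulmx1 mul1mx mask_idem. Qed.

Lemma max_parabolicM g h : Q g -> Q h -> Q (g *m h).
Proof.
move=> /max_parabolicP[gU gE] /max_parabolicP[hU hE]; apply/max_parabolicP.
split; first by rewrite /GL /= unitmx_mul [_ \in _]gU.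
by rewrite -!mulmxA hE -(mulmxA E) (mulmxA g) gE -!mulmxA (mulmxA E E) mask_idem.
Qed.

Lemma max_parabolicV g : Q g -> Q (invmx g).
Proof.
move=> /max_parabolicP[gU gE]; apply/max_parabolicP.
split; first by rewrite /GL /= unitmx_inv.
have gtU : g^T \in unitmx by rewrite unitmx_tr.
have := congr1 trmx gE; rewrite !trmx_mul !tr_mask mulmxA => /(mask_block_inv gtU).
by move/(congr1 trmx); rewrite !trmx_mul !tr_mask trmx_inv trmxK mulmxA.
Qed.

Lemma max_parabolicZ c : c != 0 -> Q c%:M.
Proof.
move=> c0; apply/max_parabolicP; split.
  by rewrite /GL /= unitmxE det_scalar unitfE expf_neq0.
by rewrite mul_mx_scalar mul_scalar_mx -scalemxAl mask_idem.
Qed.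

Lemma lcosetQ_refl g : lcosetQ d g g.
Proof. by exists 1%:M; [exact: max_parabolic1|rewrite mulmx1]. Qed.

Lemma lcosetQM g q : Q q -> lcosetQ d (g *m q) = lcosetQ d g.
Proof.
move=> Qq; apply/seteqP; split=> x [r Qr <-].
  by exists (q *m r); rewrite ?mulmxA //; apply: max_parabolicM.
exists (invmx q *m r); first by apply: max_parabolicM => //; apply: max_parabolicV.
by rewrite mulmxA mulmxK //; case: Qq.
Qed.

Lemma lcosetQ_eq g h : lcosetQ d g = lcosetQ d h -> exists2 q, Q q & h = g *m q.
Proof. by move=> gh; have := lcosetQ_refl h; rewrite -gh => -[q Qq <-]; exists q. Qed.

(** A coset is a point of the Grassmannian, determined by the span of its first d columns; the
    hypothesis places those of h in the span of those of g. *)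
Lemma eq_lcosetQ g h m : GL g -> GL h ->
  h *m E = g *m E *m m -> lcosetQ d h = lcosetQ d g.
Proof.
move=> gU hU hE; rewrite -(mulKVmx gU h) lcosetQM //.
apply/max_parabolicP; split; first by rewrite /GL /= unitmx_mul unitmx_inv [g \in _]gU.
have qE : invmx g *m h *m E = E *m m by rewrite -mulmxA hE -mulmxA mulKmx.
by rewrite -(mulmxA E) qE mulmxA mask_idem.
Qed.

Lemma lcosetQ_image g h : [set g *m y | y in lcosetQ d h] = lcosetQ d (g *m h).
Proof.
apply/seteqP; split=> x; first by case=> y [q Qq <-] <-; exists q; rewrite ?mulmxA.
by case=> q Qq <-; exists (h *m q); rewrite ?mulmxA //; exists q.
Qed.

Definition schubert_rank i g := tail_rank i (g *m E).

Definition perm_rank i (w : 'S_n) := #|[pred p | head d p && tail i (w p)]|.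

Lemma schubert_rank_perm i w : schubert_rank i (perm_mx w^-1) = perm_rank i w.
Proof. exact: tail_rank_perm. Qed.

(** The hypothesis makes the rows from i on of [g *m h] combinations of the rows from i on of h. *)
Lemma schubert_rank_stable i g h :
  mask (tail i) *m g = mask (tail i) *m g *m mask (tail i) ->
  (schubert_rank i (g *m h) <= schubert_rank i h)%N.
Proof.
move=> gi; rewrite /schubert_rank /tail_rank !mulmxA gi.
by rewrite -!mulmxA (mulmxA (mask _) g) mxrankM_maxr.
Qed.

Lemma schubert_rankQ i g q : Q q -> schubert_rank i (g *m q) = schubert_rank i g.
Proof.
suff le h r : Q r -> (schubert_rank i (h *m r) <= schubert_rank i h)%N.
  move=> Qq; apply/eqP; rewrite eqn_leq le //=.
  by rewrite -{1}(mulmxK (proj1 Qq) g) le //; apply: max_parabolicV.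
move=> /max_parabolicP[_ rE]; rewrite /schubert_rank /tail_rank -mulmxA rE !mulmxA.
by rewrite -mulmxA mxrankM_maxl.
Qed.

Lemma schubert_rank0 g : GL g -> schubert_rank 0 g = #|[pred p : 'I_n | head d p]|.
Proof.
move=> gU; rewrite /schubert_rank /tail_rank (_ : mask (tail 0) = 1%:M) ?mul1mx.
  by rewrite eqmxMfull ?row_full_unit // rank_mask.
exact: mask_predT.
Qed.

End Cosets.

(** * Minors and the Bruhat decomposition *)

Section Minors.
Variables (R : comNzRingType) (n d : nat).
Implicit Types (g : 'M[R]_n) (v : 'S_n).

(* The block matrix [[A, 0], [0, 1]], where A consists of the first d columns
   of the rows v 0, ..., v (d - 1) of g. *)
Definition minor_mx v g : 'M[R]_n :=
  mask (head d) *m perm_mx v *m g *m mask (head d) + mask (predC (head d)).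

(* A Pluecker coordinate of g Q_d. *)
Definition minor v g := \det (minor_mx v g).

Lemma minor_mxE v g p q :
  minor_mx v g p q = if head d p then (if head d q then g (v p) q else 0)
                     else (p == q)%:R.
Proof.
rewrite mxE mul_maskE -mulmxA mask_mulE perm_mulE [X in _ + X]mxE /=.
case: ifP => hq; case: ifP => hp; rewrite ?andbT ?andbF ?addr0 ?add0r //=.
Qed.

Lemma delta_mulE (x y : 'I_n) g i j : (delta_mx x y *m g) i j = (i == x)%:R * g y j.
Proof.
rewrite mxE (bigD1 y) //= big1 => [|k /negbTE ky]; first by rewrite mxE eqxx andbT addr0.
by rewrite mxE ky andbF mul0r.
Qed.

Definition shear (x y : 'I_n) (s : R) : 'M[R]_n := 1%:M + s *: delta_mx x y.

Lemma shear_mulE x y s g i j :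
  (shear x y s *m g) i j = g i j + s * (i == x)%:R * g y j.
Proof. by rewrite mulmxDl mul1mx -scalemxAl mxE [X in _ + X]mxE delta_mulE mulrA. Qed.

(** The shear alters row x only, and this minor does not use row x. *)
Lemma minor_shear x y s v g :
  ~~ head d ((v^-1)%g x) -> minor v (shear x y s *m g) = minor v g.
Proof.
move=> hx; congr (\det _); apply/matrixP => p q; rewrite !minor_mxE shear_mulE.
case: ifP => // hp; case: ifP => // _; case: eqP => [vp|_].
  by move: hp hx; rewrite -vp permK => ->.
by rewrite mulr0 mul0r addr0.
Qed.

(** Multilinearity in row x. The exchanged permutation puts row y in the position of row x, so no
    sign appears. *)
Lemma minor_shear_exchange x y s v g :
  head d ((v^-1)%g x) -> ~~ head d ((v^-1)%g y) ->
  minor v (shear x y s *m g) = minor v g + s * minor (v * tperm y x)%g g.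
Proof.
move=> hx hy.
have vx k : k != (v^-1)%g x -> (v k == x) = false.
  by move=> kx; apply: contraNF kx => /eqP <-; rewrite permK.
rewrite /minor -[X in X + _]mul1r.
apply: (@determinant_multilinear _ _ _ _ _ ((v^-1)%g x)).
- rewrite scale1r; apply/rowP => q; rewrite [LHS]mxE [RHS]mxE [X in X + _]mxE.
  rewrite [X in _ + X]mxE [X in _ * X]mxE !minor_mxE hx shear_mulE.
  rewrite permM permKV tpermR eqxx mulr1.
  by case: ifP; rewrite ?mulr0 ?mul1r ?addr0.
- apply/matrixP => p q; rewrite [LHS]mxE [RHS]mxE !minor_mxE shear_mulE.
  by rewrite vx 1?eq_sym ?neq_lift // mulr0 mul0r addr0.
apply/matrixP => p q; rewrite [LHS]mxE [RHS]mxE !minor_mxE shear_mulE.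
have np : lift ((v^-1)%g x) p != (v^-1)%g x by rewrite eq_sym neq_lift.
case: ifP => // hp; rewrite vx // permM tpermD ?mulr0 ?mul0r ?addr0 //.
  by apply: contraNneq hy => ->; rewrite permK.
by rewrite eq_sym vx.
Qed.

Lemma minor_perm v : minor v (perm_mx v^-1) = 1.
Proof.
rewrite -[RHS](det1 R n); congr (\det _); apply/matrixP => p q.
rewrite minor_mxE perm_mxVE (inj_eq perm_inj) mxE.
case: ifP => // hp; case: ifP => // hq.
by case: eqP => // pq; move: hq; rewrite -pq hp.
Qed.

End Minors.

Lemma map_minor (R S : comNzRingType) (phi : {rmorphism R -> S}) n d
    (v : 'S_n) (g : 'M[R]_n) :
  phi (minor d v g) = minor d v (map_mx phi g).
Proof.
rewrite -det_map_mx; congr (\det _); apply/matrixP => p q.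
rewrite mxE !minor_mxE mxE; case: ifP => _; last by rewrite rmorph_nat.
by case: ifP => // _; rewrite rmorph0.
Qed.

(** * Nonvanishing minors and pivot rows *)

Section MinorsAndRanks.
Variables (F : fieldType) (n d : nat).
Implicit Types (g : 'M[F]_n) (v w : 'S_n).

(** A nonzero minor makes the rows v p with p < d independent; those with i <= v p are among the
    rows counted on the right. *)
Lemma minor_neq0_rank v g i :
  minor d v g != 0 -> (perm_rank d i v <= schubert_rank d i g)%N.
Proof.
rewrite -unitfE -[minor d v g \is a _]/(_ \is a _) -unitmxE => NU.
pose D : 'M[F]_n := mask (fun p => head d p && tail i (v p)).
have <- : \rank (D *m minor_mx d v g) = perm_rank d i v.
  rewrite mxrankMfree ?row_free_unit //; exact: rank_mask.
have -> : D *m minor_mx d v g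
    = D *m (perm_mx v *m (mask (tail i) *m (g *m mask (head d)))).
  apply/matrixP => p q; rewrite !mask_mulE minor_mxE perm_mulE mask_mulE mul_maskE.
  by case: ifP => // /andP[-> ->].
by rewrite (mulmxA D) mxrankM_maxr.
Qed.

(** Equal ranks force the pivot rows to be the rows w p with p < d. By induction from the last row
    upwards, these span all rows. *)
Lemma rank_minor_neq0 w g : GL g ->
  (forall i, schubert_rank d i g = perm_rank d i w) -> minor d w g != 0.
Proof.
move=> gU gw; set E : 'M[F]_n := mask (head d).
pose N := E *m perm_mx w *m g *m E.
have sub i : (mask (tail i) *m (g *m E) <= N)%MS.
  have [ni|] := leqP n i.
    by have /eqP := tail_rank_ge (g *m E) ni; rewrite mxrank_eq0 => /eqP ->; apply: sub0mx.
  move: {2}(n - i)%N (erefl (n - i)%N) => e; elim: e i => [|e IH] i ei lin; first by lia.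
  have {}IH : (mask (tail i.+1) *m (g *m E) <= N)%MS.
    have [ni|/IH] := leqP n i.+1; last by apply; lia.
    by have /eqP := tail_rank_ge (g *m E) ni; rewrite mxrank_eq0 => /eqP ->; apply: sub0mx.
  pose k := Ordinal lin; have -> : i = k by [].
  rewrite mask_tail_step addsmx_sub IH andbT.
  (* Row k is either one of the rows of the minor, or no pivot and hence in the span of the later
     rows. *)
  have [hk|hk] := boolP (head d (w^-1 k)%g).
    have -> : row k (g *m E) = row (w^-1 k)%g N; last exact: row_sub.
    by apply/rowP => q; rewrite mxE [RHS]mxE !mul_maskE -mulmxA mask_mulE hk
      perm_mulE permKV.
  apply: submx_trans IH; apply: contraNT hk => jk.
  have := tail_rank_step (g *m E) k; rewrite /jump jk.
  rewrite -![tail_rank _ _]/(schubert_rank _ _ _) !gw /perm_rank => eqr.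
  have : (#|[pred p | head d p && tail k.+1 (w p)]|
      < #|[pred p | head d p && tail k (w p)]|)%N.
    by rewrite eqr.
  apply: contraLR => hk; rewrite -leqNgt; apply/subset_leq_card/fintype.subsetP => p.
  rewrite !inE /tail leq_eqVlt => /andP[hp /orP[/eqP/val_inj kw|->]].
    by move: hk; rewrite kw permK hp.
  by rewrite hp.
(* The row space of [N] lies in that of [E] and, by [sub 0], has at least the same dimension. *)
have rN : (E <= N)%MS.
  have le : (N <= E)%MS by rewrite submxMl.
  rewrite -(mxrank_leqif_sup le) eqn_leq (mxrankS le) /=.
  rewrite {1}/E rank_mask -(schubert_rank0 d gU); apply: mxrankS (sub 0%N).
rewrite -unitfE -[minor d w g]/(\det _) -unitmxE -row_full_unit -sub1mx.
have -> : 1%:M = E + mask (predC (head d)) :> 'M[F]_n by rewrite mask_compl addrC subrK.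
have EM : N = E *m minor_mx d w g.
  by apply/matrixP => p q; rewrite mask_mulE minor_mxE /N mul_maskE -mulmxA
    mask_mulE perm_mulE; do !case: ifP.
have CM : mask (predC (head d)) = mask (predC (head d)) *m minor_mx d w g :> 'M[F]_n.
  apply/matrixP => p q; rewrite mask_mulE minor_mxE mxE /=.
  by case: (head d p); rewrite ?andbF ?andbT.
apply: addmx_sub; last by rewrite CM submxMl.
by apply: submx_trans rN _; rewrite EM submxMl.
Qed.

(** The whole type is listed twice, with A first and with B first, and the two lists are matched
    position by position. *)
Lemma perm_of_card (T : finType) (A B : pred T) :
  #|A| = #|B| -> exists s : {perm T}, forall p, B (s p) = A p.
Proof.
move=> AB; pose s1 := enum A ++ enum (predC A); pose s2 := enum B ++ enum (predC B).
have full (C : pred T) x : x \in enum C ++ enum (predC C).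
  by rewrite mem_cat !mem_enum !inE orbN.
have size_s (C : pred T) : size (enum C ++ enum (predC C)) = #|T|.
  by rewrite size_cat -!cardE cardC.
have uniq_s (C : pred T) : uniq (enum C ++ enum (predC C)).
  rewrite cat_uniq !enum_uniq andbT /=; apply/hasPn => x.
  by rewrite !mem_enum !inE.
pose f x := nth x s2 (index x s1).
have lt x : (index x s1 < size s2)%N by rewrite size_s -(size_s A) index_mem full.
have f_inj : injective f.
  move=> x y /eqP; rewrite /f (set_nth_default y x (lt x)) nth_uniq ?lt ?uniq_s // => /eqP.
  by move=> eqi; have := nth_index x (full A x); rewrite -/s1 eqi nth_index ?full.
exists (perm f_inj) => x; rewrite permE /f nth_cat index_cat mem_enum -cardE.
have [Ax|nAx] := boolP (x \in A).
  have lx : (index x (enum A) < #|B|)%N by rewrite -AB cardE index_mem mem_enum.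
  have : nth x (enum B) (index x (enum A)) \in enum B by rewrite mem_nth // -cardE.
  by rewrite lx mem_enum !unfold_in in Ax * => ->.
rewrite -cardE AB ltnNge leq_addr /= addKn.
have lx : (index x (enum (predC A)) < size (enum (predC B)))%N.
  suff -> : size (enum (predC B)) = size (enum (predC A)) by rewrite index_mem mem_enum.
  by rewrite -!cardE; apply/eqP; rewrite -(eqn_add2l #|A|) {1}AB !cardC.
have := mem_nth x lx; rewrite mem_enum inE /= => /negbTE.
by rewrite !unfold_in in nAx * => ->; rewrite (negbTE nAx).
Qed.

(* The pivot rows of the first d columns of g give v; reducing these columns to
   the pivots gives b. *)
Lemma bruhat g : GL g -> exists (v : 'S_n) (b : 'M[F]_n),
  [/\ borel b, lcosetQ d g = lcosetQ d (b *m perm_mx v^-1)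
    & forall i, schubert_rank d i g = perm_rank d i v].
Proof.
move=> gU; set E : 'M[F]_n := mask (head d); pose A := g *m E; pose J := jump A.
have [v vJ] : exists v : 'S_n, forall p, J (v p) = head d p.
  apply: perm_of_card; rewrite -(schubert_rank0 d gU) /schubert_rank tail_rank_jump.
  by apply: eq_card => k; rewrite !inE.
(* A column of the cokernel of the later rows, rescaled, combines the columns of [A] to a vector
   with 1 at the pivot k and 0 below it. *)
have pivot k : exists y : 'cV[F]_n, J k ->
    (A *m y) k 0 = 1 /\ forall i : 'I_n, (k < i)%N -> (A *m y) i 0 = 0.
  pose B := mask (tail k.+1) *m A.
  have [z|/rV0Pn[l]] := eqVneq (row k A *m cokermx B) 0.
    by exists 0 => /negP[]; apply/submxP; move/eqP: z; rewrite -submxE => /submxP.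
  rewrite -row_mul mxE => nz.
  exists (((A *m cokermx B) k l)^-1 *: col l (cokermx B)) => _.
  have AyE i : (A *m col l (cokermx B)) i 0 = (A *m cokermx B) i l.
    by rewrite mxE [RHS]mxE; apply: eq_bigr => j _; rewrite [col _ _ _ _]mxE.
  rewrite -scalemxAr; split=> [|i ki]; rewrite mxE AyE; first by rewrite mulVf.
  have /matrixP/(_ i l) : B *m cokermx B = 0 by rewrite mulmx_coker.
  by rewrite -mulmxA mask_mulE /tail ki => ->; rewrite [X in _ * X]mxE mulr0.
pose y k := projT1 (cid (pivot k)).
(* Reduced columns at the pivots and basis columns elsewhere make [b] upper unitriangular. *)
pose b : 'M[F]_n := \matrix_(i, k) if J k then (A *m y k) i 0 else (i == k)%:R.
have b0 (p q : 'I_n) : (q < p)%N -> b p q = 0.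
  move=> qp; rewrite mxE; case: ifP => Jq; last by rewrite -val_eqE gtn_eqF.
  by rewrite /y; case: cid => /= z /(_ Jq)[_]; apply.
have b1 p : b p p = 1.
  rewrite mxE eqxx; case: ifP => Jp //.
  by rewrite /y; case: cid => /= z /(_ Jp)[].
have bU : b \in unitmx.
  rewrite unitmxE -det_tr det_trig; last by apply/is_trig_mxP => i j ij; rewrite mxE b0.
  by rewrite big1 ?unitr1 // => i _; rewrite mxE b1.
exists v, b; split=> //.
(* The coefficients expressing the pivot columns of [b] through the first d columns of g. *)
- pose m : 'M[F]_n := \matrix_(i, p) if head d p then y (v p) i 0 else 0.
  apply/esym/(@eq_lcosetQ _ _ _ _ _ m) => //.
    by rewrite /GL /= unitmx_mul bU unitmx_perm.
  apply/matrixP => i p; rewrite mul_maskE mul_permE mxE vJ [RHS]mxE.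
  case: ifP => hp.
    by rewrite hp [LHS]mxE; apply: eq_bigr => k _; rewrite [X in _ = _ * X]mxE hp.
  by rewrite big1 // => k _; rewrite [X in _ * X]mxE hp mulr0.
move=> i; rewrite /schubert_rank tail_rank_jump /perm_rank -!sum1_card.
rewrite (reindex_inj (@perm_inj _ v)); apply: eq_bigl => p.
by rewrite !inE -[jump _ _]/(J _) vJ andbC.
Qed.

End MinorsAndRanks.

(** * Closed sets *)

Section PolynomialFunctions.
Variables (F : fieldType) (n : nat).
Implicit Types (f : {mpoly F[n * n]}) (g : 'M[F]_n).

Definition peval f g : F := f.@[fun k => mxvec g 0 k].

(** The coefficient ring is left open: it is [{poly F}] for curves, [{mpoly F[n * n]}] for
    translates of functions, and polynomials over the latter for families of curves. *)
Definition psubst (A : comNzRingType) (iota : F -> A) f (M : 'M[A]_n) : A :=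
  mmap iota (fun k => mxvec M 0 k) f.

Lemma rmorph_psubst (A : comNzRingType) (iota : F -> A)
    (phi : {rmorphism A -> F}) f M :
  cancel iota phi -> phi (psubst iota f M) = peval f (map_mx phi M).
Proof.
move=> iotaK; rewrite /peval /psubst /meval /mmap rmorph_sum.
apply: eq_bigr => m _; rewrite rmorphM iotaK /mmap1 rmorph_prod; congr (_ * _).
by apply: eq_bigr => k _; rewrite rmorphXn -map_mxvec mxE.
Qed.

Definition peval_at g : {rmorphism {mpoly F[n * n]} -> F} :=
  meval (fun k => mxvec g 0 k).

Definition generic_mx : 'M[{mpoly F[n * n]}]_n := \matrix_(i, j) 'X_(mxvec_index i j).

Lemma peval_atE g f : peval_at g f = peval f g.
Proof. by []. Qed.

Lemma peval_atC g c : peval_at g c%:MP = c.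
Proof. exact: mevalC. Qed.

Lemma map_generic_mx g : map_mx (peval_at g) generic_mx = g.
Proof. by apply/matrixP => i j; rewrite !mxE /= mevalXU mxvecE. Qed.

Definition pcomp f (M : 'M[{mpoly F[n * n]}]_n) : {mpoly F[n * n]} :=
  psubst (@mpolyC _ F) f M.

Lemma peval_comp f M g : peval (pcomp f M) g = peval f (map_mx (peval_at g) M).
Proof. by apply: (rmorph_psubst (phi := peval_at g)) => x; rewrite /= mevalC. Qed.

Lemma map_constant_mx m p (A : 'M[F]_(m, p)) g :
  map_mx (peval_at g) (map_mx (@mpolyC _ F) A) = A.
Proof. by apply/matrixP => i j; rewrite !mxE /= mevalC. Qed.

Lemma peval_line f (M : 'M[{poly F}]_n) : exists P : {poly F},
  forall s, P.[s] = peval f (map_mx (horner_eval s) M).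
Proof.
exists (psubst polyC f M) => s; rewrite -horner_evalE.
by apply: rmorph_psubst => x; rewrite /= horner_evalE hornerC.
Qed.

Lemma map_mask (A B : comNzRingType) (phi : {rmorphism A -> B}) (S : pred 'I_n) :
  map_mx phi (mask S) = mask S.
Proof. by apply/matrixP => i j; rewrite !mxE rmorph_nat. Qed.

End PolynomialFunctions.

Lemma map_shear_family (A B : comNzRingType) (phi : {rmorphism A -> B}) n
    (x y : 'I_n) (l a b : A) (X : 'M[A]_n) :
  map_mx phi (l *: (a *: X + b *: (delta_mx x y *m X)))
  = phi l *: (phi a *: map_mx phi X + phi b *: (delta_mx x y *m map_mx phi X)).
Proof. by rewrite map_mxZ map_mxD !map_mxZ map_mxM map_delta_mx. Qed.

(** The coefficients, functions of a matrix, are evaluated at g, and the curve parameter at s. *)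
Definition peval_at2 (F : fieldType) n (g : 'M[F]_n) (s : F) :
    {rmorphism {poly {mpoly F[n * n]}} -> F} :=
  horner_eval s \o map_poly (peval_at g).

Section EvaluationTwice.
Variables (F : fieldType) (n : nat) (g : 'M[F]_n) (s : F).
Lemma peval_at2E p : peval_at2 g s p = (map_poly (peval_at g) p).[s].
Proof. by []. Qed.

Lemma peval_at2C p : peval_at2 g s p%:P = peval_at g p.
Proof. by rewrite peval_at2E map_polyC hornerC. Qed.

Lemma peval_at2X p : peval_at2 g s ('X - p%:P) = s - peval_at g p.
Proof. by rewrite rmorphB peval_at2C peval_at2E map_polyX hornerX. Qed.

Lemma peval_at2_generic : map_mx (peval_at2 g s) (map_mx polyC (@generic_mx F n)) = g.
Proof.
apply/matrixP => i j; rewrite mxE [X in peval_at2 _ _ X]mxE peval_at2C.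
by rewrite -[in RHS](map_generic_mx g) [RHS]mxE.
Qed.
End EvaluationTwice.

(** A maximal independent set of rows, and then of columns, gives an invertible submatrix whose size
    is the rank. Selections with repetitions are harmless, as their determinants vanish. *)
Lemma rank_minorsP (F : fieldType) m n (A : 'M[F]_(m, n)) k :
  (\rank A <= k)%N <->
  forall r (f : 'I_r -> 'I_m) (h : 'I_r -> 'I_n), (k < r)%N -> \det (mxsub f h A) = 0.
Proof.
split=> [Ak r f h kr|A0].
  apply: contraTeq kr => det0; rewrite -leqNgt.
  have /mxrank_unit <- : mxsub f h A \in unitmx by rewrite unitmxE unitfE.
  apply: leq_trans Ak; rewrite -[A in mxsub _ _ A]mulmx1 mxsub_mul.
  by apply: leq_trans (mxrankM_maxl _ _) _; rewrite rowsubE mxrankM_maxr.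
rewrite leqNgt; apply/negP => kr.
pose B := rowsub (maxrankfun A) A.
have fullB : row_full B^T by rewrite /row_full mxrank_tr -/(row_free B) maxrowsub_free.
have := fullrowsub_unit fullB; rewrite unitmxE unitfE -det_tr.
suff -> : (rowsub (fullrankfun fullB) B^T)^T = mxsub (maxrankfun A) (fullrankfun fullB) A.
  by rewrite A0 ?eqxx.
by apply/matrixP => i j; rewrite !mxE.
Qed.

Section ClosedSets.
Variables (F : fieldType) (n d : nat).
Implicit Types (g h : 'M[F]_n) (Z : set (set 'M[F]_n)).

Lemma GLmodQ_closedP Z : GLmodQ_closed d Z <->
  Z `<=` GLmodQ d /\ exists S : set {mpoly F[n * n]}, forall g, GL g ->
    Z (lcosetQ d g) <-> forall f, S f -> peval f g = 0.
Proof.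
split=> -[ZG [S SZ]]; split=> //; exists S.
  move=> g gU; move/seteqP: SZ => [SZ1 SZ2]; split=> [Zg|Sg].
    by have [] := SZ1 g (conj gU Zg).
  by have [] := SZ2 g (conj gU Sg).
by apply/seteqP; split=> g [gU gS]; split=> //; apply/(SZ g gU).
Qed.

(** Since f may fail to be invariant under Q_d, the equations are all the right translates of f by
    elements of Q_d. *)
Lemma GLmodQ_closed_peval (f : {mpoly F[n * n]}) :
  GLmodQ_closed d [set x | GLmodQ d x /\ forall g, x g -> peval f g = 0].
Proof.
apply/GLmodQ_closedP; split; first by move=> x [].
exists [set pcomp f (@generic_mx F n *m map_mx (@mpolyC _ F) q)
  | q in @max_parabolic F n d] => g gU.
split=> [[_ fg] _ [q Qq <-]|fg].
  by rewrite peval_comp map_mxM map_generic_mx map_constant_mx fg //; exists q.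
split; first by exists g.
move=> _ [q Qq <-]; rewrite -[q in g *m q](map_constant_mx _ g).
rewrite -[g in g *m _]map_generic_mx.
by rewrite -map_mxM -peval_comp; apply: fg; exists q.
Qed.

Definition rank_variety (w : 'S_n) : set (set 'M[F]_n) :=
  [set lcosetQ d g | g in [set g | GL g /\
    forall i, (schubert_rank d i g <= perm_rank d i w)%N]].

Lemma rank_varietyP w g : GL g -> rank_variety w (lcosetQ d g) <->
  forall i, (schubert_rank d i g <= perm_rank d i w)%N.
Proof.
move=> gU; split=> [[h [hU hw] /esym/lcosetQ_eq[q Qq hg]] i|gw]; last by exists g.
by have := hw i; rewrite hg schubert_rankQ.
Qed.

Lemma rank_variety_sub w : rank_variety w `<=` GLmodQ d.
Proof. by move=> x [g [gU _] <-]; exists g. Qed.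

Lemma rank_variety_closed w : GLmodQ_closed d (rank_variety w).
Proof.
apply/GLmodQ_closedP; split; first exact: rank_variety_sub.
pose T i := mask (tail i) *m (@generic_mx F n *m mask (head d)).
exists [set p | exists i r (f h : 'I_r -> 'I_n), (perm_rank d i w < r)%N /\
  p = \det (mxsub f h (T i))] => g gU.
have det_T i r (f h : 'I_r -> 'I_n) : peval (\det (mxsub f h (T i))) g
    = \det (mxsub f h (mask (tail i) *m (g *m mask (head d)))).
  rewrite -[peval _ g]/(peval_at g _) -det_map_mx map_mxsub !map_mxM map_generic_mx.
  by rewrite !map_mask.
apply: iff_trans (rank_varietyP _ gU) _; split=> [gw p [i [r [f [h [ir ->]]]]]|H i].
  by rewrite det_T; apply: (proj1 (rank_minorsP _ _) (gw i)).
apply/rank_minorsP => r f h ir; rewrite -det_T; apply: H.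
by exists i, r, f, h.
Qed.

End ClosedSets.

(** * Schubert varieties as rank varieties *)

Section PermutationRanks.
Variables (n d : nat).
Implicit Types (v w : 'S_n).

Lemma perm_rank_step w (k : 'I_n) :
  perm_rank d k w = (head d (w^-1 k)%g + perm_rank d k.+1 w)%N.
Proof.
rewrite /perm_rank (cardD1 (w^-1 k)%g) !inE permKV /tail leqnn andbT; congr addn.
apply: eq_card => p; rewrite !inE -(can2_eq (permK w) (permKV w)) -val_eqE /=.
by rewrite andbCA [in RHS]ltn_neqAle eq_sym.
Qed.

Lemma perm_rank_ge i w : (n <= i)%N -> perm_rank d i w = 0%N.
Proof.
move=> ni; apply: eq_card0 => p; rewrite !inE /tail leqNgt.
by rewrite (leq_trans (ltn_ord _) ni) andbF.
Qed.

Lemma perm_rank0 w : perm_rank d 0 w = #|[pred p : 'I_n | head d p]|.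
Proof. by apply: eq_card => p; rewrite !inE andbT. Qed.

(** Lowering the entry x by one is noticed only by the threshold x. *)
Lemma perm_rank_exchange w (x y : 'I_n) i :
  y.+1 = x :> nat -> head d (w^-1 x)%g -> ~~ head d (w^-1 y)%g ->
  perm_rank d i w = ((i == x) + perm_rank d i (w * tperm y x)%g)%N.
Proof.
move=> yx hx hy; have wy p : head d p -> w p != y.
  by move=> hp; apply: contraNneq hy => <-; rewrite permK.
have [->|nix] := eqVneq i x.
  rewrite perm_rank_step hx /perm_rank; congr addn; apply: eq_card => p; rewrite !inE.
  have [hp|//] := boolP (head d p); rewrite /= permM /tail.
  case: tpermP => [wpy|wpx|_ /eqP wpx]; first by have := wy p hp; rewrite wpy eqxx.
    by rewrite wpx; lia.
  by rewrite ltn_neqAle eq_sym val_eqE wpx.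
apply: eq_card => p; rewrite !inE.
have [hp|//] := boolP (head d p); rewrite /= permM /tail.
case: tpermP => [wpy|wpx|//]; first by have := wy p hp; rewrite wpy eqxx.
by rewrite wpx; lia.
Qed.

(** Take the least entry x of w at which the inequality is strict. Then x - 1 is not an entry, and
    lowering x costs one only at the threshold x, where there is room. *)
Lemma perm_rank_exists_exchange v w :
  (forall i, (perm_rank d i v <= perm_rank d i w)%N) ->
  (exists i, perm_rank d i v != perm_rank d i w) ->
  exists x y : 'I_n, [/\ y.+1 = x :> nat, head d (w^-1 x)%g, ~~ head d (w^-1 y)%g &
    forall i, (perm_rank d i v <= perm_rank d i (w * tperm y x)%g)%N].
Proof.
move=> vw [i0 ne0].
pose strict i := (perm_rank d i v < perm_rank d i w)%N.
have [i0n|] := ltnP i0 n; last by move=> ni; rewrite !perm_rank_ge ?eqxx in ne0.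
(* Going up from [i0], strictness persists past values that are not entries of w; it fails from n
   on, so an entry is met. *)
have : exists i : 'I_n, strict i && head d (w^-1 i)%g.
  have : strict i0 by rewrite /strict ltn_neqAle ne0 vw.
  clear ne0; move: {2}(n - i0)%N (erefl (n - i0)%N) => e.
  elim: e i0 i0n => [|e IH] i i_n ei si; first by lia.
  pose k := Ordinal i_n.
  have [hk|hk] := boolP (head d (w^-1 k)%g); first by exists k; rewrite hk andbT.
  have siS : strict i.+1.
    move: si; rewrite /strict (perm_rank_step v k) (perm_rank_step w k) (negbTE hk) /=.
    by case: head; rewrite ?add1n ?add0n // => /ltnW.
  apply: (IH i.+1) => //; last by lia.
  by rewrite ltnNge; apply: contraL siS => ni; rewrite /strict !perm_rank_ge.
case=> x0 Px0.
have [x /andP[sx hx] x_min] := @arg_minnP _ x0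
  [pred i : 'I_n | strict i && head d (w^-1 i)%g] (@nat_of_ord n) Px0.
have x0' : (0 < x)%N.
  by rewrite lt0n; apply: contraL sx => /eqP ->; rewrite /strict !perm_rank0 ltnn.
have yn : (x.-1 < n)%N by have := ltn_ord x; lia.
pose y := Ordinal yn; have yx : y.+1 = x :> nat by rewrite /= prednK.
have hy : ~~ head d (w^-1 y)%g.
  (* If y were an entry of w, strictness at x would give strictness at y, against minimality. *)
  apply/negP => hy; suff /x_min : strict y && head d (w^-1 y)%g by rewrite /=; lia.
  rewrite hy andbT /strict (perm_rank_step v y) (perm_rank_step w y) hy yx.
  by move: sx; rewrite /strict; case: head; lia.
exists x, y; split=> // i; have := perm_rank_exchange i yx hx hy.
have [->|_] := eqVneq i x; last by rewrite add0n => <-.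
by move: sx; rewrite /strict => + eqx; rewrite eqx.
Qed.

End PermutationRanks.

(** * Closures of cells *)

Section SchubertVarietiesByRanks.
Variables (F : numFieldType) (n d : nat).
Implicit Types (g h b : 'M[F]_n) (v w : 'S_n) (Z : set (set 'M[F]_n)).

Lemma poly_nonroot (P : {poly F}) : P != 0 -> exists s, P.[s] != 0.
Proof.
move=> P0; apply: contrapT => /forallNP roots.
have := @max_poly_roots _ P [seq k%:R | k <- iota 0 (size P)] P0.
rewrite size_map size_iota ltnn => H; suff: false by []; apply: H.
  by apply/allP => s _; rewrite rootE; apply/negPn/negP/roots.
by rewrite map_inj_uniq ?iota_uniq // => i j /eqP; rewrite eqr_nat => /eqP.
Qed.

(** Each equation of Z, restricted to the curve and multiplied by D, has only zero values; over an
    infinite field it is the zero polynomial, and D cancels. *)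
Lemma closed_line Z (M : 'M[{poly F}]_n) (D : {poly F}) :
  GLmodQ_closed d Z -> D != 0 ->
  (forall s, D.[s] != 0 -> GL (map_mx (horner_eval s) M) /\
     Z (lcosetQ d (map_mx (horner_eval s) M))) ->
  forall s, GL (map_mx (horner_eval s) M) -> Z (lcosetQ d (map_mx (horner_eval s) M)).
Proof.
move=> /GLmodQ_closedP[_ [S SZ]] D0 DM s sU; apply/(SZ _ sU) => f Sf.
have [P Pf] := peval_line f M; rewrite -Pf.
have : P * D = 0.
  have [//|/poly_nonroot[t]] := eqVneq (P * D) 0; rewrite hornerM Pf.
  have [->|/DM[tU /(SZ _ tU) -> //]] := eqVneq D.[t] 0; first by rewrite mulr0 eqxx.
  by rewrite mul0r eqxx.
by move/eqP; rewrite mulf_eq0 (negbTE D0) orbF => /eqP ->; rewrite horner0.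
Qed.

Lemma borelM b c : borel b -> borel c -> borel (b *m c).
Proof.
move=> [bU bT] [cU cT]; split; first by rewrite /GL /= unitmx_mul [b \in _]bU.
move=> p q qp; rewrite mxE big1 // => k _.
have [kp|pk] := ltnP k p; first by rewrite bT ?mul0r.
by rewrite cT ?mulr0 // (leq_trans qp).
Qed.

Lemma shearE (x y : 'I_n) (s : F) i j :
  shear x y s i j = (i == j)%:R + s * ((i == x) && (j == y))%:R.
Proof. by rewrite !mxE. Qed.

Lemma shear_unit (x y : 'I_n) (s : F) : x != y -> shear x y s \in unitmx.
Proof.
move=> xy; have /mulmx1_unit[] // : shear x y s *m shear x y (- s) = 1%:M.
apply/matrixP => i j; rewrite shear_mulE !shearE mxE [y == x]eq_sym (negbTE xy).
rewrite mulr0 addr0 [y == j]eq_sym -addrA -mulrA -natrM mulnb -mulrDl addNr.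
by rewrite mul0r addr0.
Qed.

Lemma shear_borel (x y : 'I_n) (s : F) : (x < y)%N -> borel (shear x y s).
Proof.
move=> xy; split; first by apply: shear_unit; rewrite -val_eqE ltn_eqF.
move=> p q qp; rewrite !mxE -!val_eqE gtn_eqF //= add0r.
have [px|_] := eqVneq (p : nat) x; last by rewrite mulr0.
by rewrite [(q : nat) == y]ltn_eqF ?mulr0 //; lia.
Qed.

Lemma borel1 : borel (1%:M : 'M[F]_n).
Proof.
split; first by rewrite /GL /= unitmx1.
by move=> p q qp; rewrite mxE -val_eqE gtn_eqF.
Qed.

(** The vectors e_y + s e_x and e_x + s^-1 e_y span the same line. The diagonal matrix records the
    factor s between them. *)
Lemma lcosetQ_shear (x y : 'I_n) (s : F) b w : GL b -> x != y -> s != 0 ->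
  head d (w^-1 x)%g -> ~~ head d (w^-1 y)%g ->
  lcosetQ d (b *m shear x y s *m perm_mx (w * tperm y x)^-1)
  = lcosetQ d (b *m shear y x s^-1 *m perm_mx w^-1).
Proof.
move=> bU xy s0 hx hy.
apply: (@eq_lcosetQ _ _ _ _ _ (diag_mx (\row_j if j == (w^-1 x)%g then s else 1))).
- by rewrite /GL /= !unitmx_mul [b \in _]bU shear_unit 1?eq_sym // unitmx_perm.
- by rewrite /GL /= !unitmx_mul [b \in _]bU shear_unit // unitmx_perm.
rewrite -!mulmxA; congr (_ *m _); rewrite !mulmxA; apply/matrixP => i j.
rewrite mul_mx_diag [RHS]mxE !mul_maskE; case: ifP => hj; last by rewrite mul0r.
rewrite !mul_permE permM !shearE mxE.
have wy : (w j == y) = false by apply: contraNF hy => /eqP <-; rewrite permK.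
rewrite -(can2_eq (permK w) (permKV w)); case: tpermP => [wjy|wjx|_ /eqP/negbTE wjx].
- by rewrite wjy eqxx in wy.
- by rewrite wjx !eqxx !andbT mulrDl mulrAC mulVf // mul1r addrC mulrC.
by rewrite wy wjx !andbF !mulr0 !addr0 mulr1.
Qed.

(* For s != 0 the coset of shear x y s * w' lies in the cell of w, and at s = 0
   it is the coset of w'. *)
Lemma schubert_cell_exchange Z w (x y : 'I_n) :
  GLmodQ_closed d Z -> schubert_cell d w `<=` Z -> y.+1 = x :> nat ->
  head d (w^-1 x)%g -> ~~ head d (w^-1 y)%g ->
  schubert_cell d (w * tperm y x)%g `<=` Z.
Proof.
move=> Zc wZ yx hx hy _ [b bB <-]; have xy : x != y by rewrite -val_eqE /= -yx; lia.
pose t := (w * tperm y x)%g.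
pose M : 'M[{poly F}]_n := map_mx polyC b *m shear x y 'X *m perm_mx t^-1.
have ME s : map_mx (horner_eval s) M = b *m shear x y s *m perm_mx t^-1.
  rewrite !map_mxM map_perm_mx; congr (_ *m _ *m _); apply/matrixP => i j; rewrite !mxE /=.
    by rewrite horner_evalE hornerC.
  by rewrite horner_evalE hornerD hornerM hornerX -!polyC_natr !hornerC.
have MU s : GL (map_mx (horner_eval s) M).
  by rewrite ME /GL /= !unitmx_mul [b \in _](proj1 bB) shear_unit // unitmx_perm.
have := @closed_line Z M 'X Zc (negbT (polyX_eq0 F)) _ 0 (MU 0).
rewrite ME /shear scale0r addr0 mulmx1; apply => s; rewrite hornerX => s0.
split; first exact: MU.
rewrite ME lcosetQ_shear //; last exact: (proj1 bB).
apply: wZ; exists (b *m shear y x s^-1) => //; apply: borelM => //.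
by apply: shear_borel; rewrite -yx.
Qed.

(** Differences of consecutive ranks recover the set of the first d entries, so v and w differ by a
    permutation matrix in Q_d. *)
Lemma lcosetQ_perm b v w : (forall i, perm_rank d i v = perm_rank d i w) ->
  lcosetQ d (b *m perm_mx v^-1) = lcosetQ d (b *m perm_mx w^-1).
Proof.
move=> vw; have vwh k : head d (v^-1 k)%g = head d (w^-1 k)%g.
  have := vw k; rewrite !perm_rank_step vw => /eqP; rewrite eqn_add2r.
  by do 2 case: head.
have -> : b *m perm_mx v^-1 = b *m perm_mx w^-1 *m (perm_mx w *m perm_mx v^-1).
  by rewrite -!mulmxA -!perm_mxM mulKg.
apply/lcosetQM/max_parabolicP; split; first by rewrite /GL /= unitmx_mul !unitmx_perm.
apply/matrixP => i j; rewrite mul_maskE -mulmxA mask_mulE mul_maskE perm_mulE perm_mxVE.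
case: ifP => hj; last by rewrite if_same.
case: ifP => // hi; case: eqP => // wv.
by move: hi; rewrite -(permK w i) wv -vwh permK hj.
Qed.

(** Induction on the sum of the ranks of w, which drops by one with each exchange towards v. *)
Lemma schubert_cell_closure Z v w : GLmodQ_closed d Z -> schubert_cell d w `<=` Z ->
  (forall i, (perm_rank d i v <= perm_rank d i w)%N) -> schubert_cell d v `<=` Z.
Proof.
move=> Zc; have [N] := ubnP (\sum_(i < n) perm_rank d i w)%N.
elim: N w => // N IH w; rewrite ltnS => wN wZ vw.
have [ex|/forallNP same] := pselect (exists i, perm_rank d i v != perm_rank d i w);
  last first.
  move=> _ [b bB <-]; apply: wZ; exists b => //; apply/esym/lcosetQ_perm => i.
  by apply/eqP/negPn/negP/same.
have [x [y [yx hx hy vt]]] := perm_rank_exists_exchange vw ex.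
apply: (IH (w * tperm y x)%g) => //; last exact: schubert_cell_exchange.
apply: leq_trans wN; rewrite [leqRHS](eq_bigr (fun i : 'I_n =>
  ((i == x) + perm_rank d i (w * tperm y x)%g)%N)); last first.
  by move=> i _; rewrite (perm_rank_exchange i yx hx hy).
by rewrite big_split /= [X in (X + _)%N](bigD1 x) //= eqxx -addnA add1n ltnS leq_addl.
Qed.

Lemma borel_tail b i : borel b ->
  mask (tail i) *m b = mask (tail i) *m b *m mask (tail i).
Proof.
move=> [_ bT]; apply/matrixP => p q; rewrite mul_maskE mask_mulE /tail.
by case: ifP => // ip; case: leqP => // qi; rewrite bT // (leq_trans qi).
Qed.

Lemma schubert_cell_rank w : schubert_cell d w `<=` @rank_variety F n d w.
Proof.
move=> _ [b bB <-]; apply/rank_varietyP.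
  by rewrite /GL /= unitmx_mul [b \in _](proj1 bB) unitmx_perm.
move=> i; rewrite -(schubert_rank_perm F); apply: schubert_rank_stable.
exact: borel_tail.
Qed.

(** The rank conditions are closed and hold on the cell. Conversely, the Bruhat decomposition puts
    each point satisfying them in the cell of some v with smaller ranks. *)
Lemma schubertE w : schubert F d w = @rank_variety F n d w.
Proof.
apply/seteqP; split=> x.
  by apply; split; [exact: rank_variety_closed|exact: schubert_cell_rank].
move=> [g [gU gw] <-] Z [Zc wZ].
have [v [b [bB -> gv]]] := bruhat d gU.
apply: (@schubert_cell_closure Z v w) => //; last by exists b.
by move=> i; rewrite -gv.
Qed.

Lemma schubert_closed w : GLmodQ_closed d (schubert F d w).
Proof. by rewrite schubertE; apply: rank_variety_closed. Qed.

Lemma cell_sub_schubert w : schubert_cell d w `<=` schubert F d w.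
Proof. by rewrite schubertE; exact: schubert_cell_rank. Qed.

Lemma schubert_min w Z : GLmodQ_closed d Z -> schubert_cell d w `<=` Z ->
  schubert F d w `<=` Z.
Proof. by move=> Zc wZ x; apply. Qed.

(* Points of the cell outside two closed sets are joined by a line in the space
   of upper triangular matrices; a generic point of it avoids both sets. *)
Lemma schubert_irreducible w : irreducible_closed d (schubert F d w).
Proof.
split; first exact: schubert_closed.
  exists (lcosetQ d (1%:M *m perm_mx w^-1)); apply: cell_sub_schubert.
  by exists 1%:M => //; apply: borel1.
move=> Z1 Z2 Z1c Z2c sub.
have [s1|/existsNP[_ /not_implyP[[b1 b1B <-] nb1]]] := pselect (schubert_cell d w `<=` Z1).
  by left; apply: schubert_min.
have [s2|/existsNP[_ /not_implyP[[b2 b2B <-] nb2]]] := pselect (schubert_cell d w `<=` Z2).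
  by right; apply: schubert_min.
exfalso.
pose L : 'M[{poly F}]_n := map_mx polyC b1 + 'X *: map_mx polyC (b2 - b1).
pose M := L *m perm_mx w^-1.
have LE s : map_mx (horner_eval s) L = b1 + s *: (b2 - b1).
  by apply/matrixP => i j; rewrite !mxE /= horner_evalE hornerD hornerM hornerX !hornerC.
have ME s : map_mx (horner_eval s) M = (b1 + s *: (b2 - b1)) *m perm_mx w^-1.
  by rewrite map_mxM map_perm_mx LE.
have L0 : map_mx (horner_eval 0) L = b1 by rewrite LE scale0r addr0.
have L1 : map_mx (horner_eval 1) L = b2 by rewrite LE scale1r addrC subrK.
have detL s : (\det L).[s] = \det (map_mx (horner_eval s) L).
  by rewrite -horner_evalE -det_map_mx.
have LB s : (\det L).[s] != 0 -> borel (map_mx (horner_eval s) L).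
  rewrite detL -unitfE -unitmxE => U; split=> // p q qp.
  by rewrite LE !mxE (proj2 b1B) // (proj2 b2B) // subrr mulr0 addr0.
(* An equation of Z that fails at the parameter t restricts to a nonzero polynomial on the line, and
   off its roots the line avoids Z. *)
have avoid Z t : GLmodQ_closed d Z -> borel (map_mx (horner_eval t) L) ->
    ~ Z (lcosetQ d (map_mx (horner_eval t) M)) ->
    exists P : {poly F}, P != 0 /\ forall s, (\det L).[s] != 0 ->
      P.[s] != 0 -> ~ Z (lcosetQ d (map_mx (horner_eval s) M)).
  move=> /GLmodQ_closedP[_ [S SZ]] tB nZ.
  have GLM s : borel (map_mx (horner_eval s) L) -> GL (map_mx (horner_eval s) M).
    by move=> [sU _]; rewrite ME -LE /GL /= unitmx_mul [_ \in _]sU unitmx_perm.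
  have [f [Sf ft]] : exists f, S f /\ peval f (map_mx (horner_eval t) M) != 0.
    apply: contrapT => /forallNP H; apply: nZ; apply/(SZ _ (GLM _ tB)) => f Sf.
    by have [//|nf] := eqVneq (peval f (map_mx (horner_eval t) M)) 0; case: (H f).
  have [P Pf] := peval_line f M; exists P; split.
    by apply: contraNneq ft => P0; rewrite -Pf P0 horner0.
  move=> s /LB/GLM sU Ps /(SZ _ sU)/(_ _ Sf) fs.
  by rewrite Pf fs eqxx in Ps.
have B0 : borel (map_mx (horner_eval 0) L) by rewrite L0.
have B1 : borel (map_mx (horner_eval 1) L) by rewrite L1.
have N0 : ~ Z1 (lcosetQ d (map_mx (horner_eval 0) M)) by rewrite ME -LE L0.
have N1 : ~ Z2 (lcosetQ d (map_mx (horner_eval 1) M)) by rewrite ME -LE L1.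
have [P1 [P10 H1]] := avoid _ _ Z1c B0 N0.
have [P2 [P20 H2]] := avoid _ _ Z2c B1 N1.
have D0 : \det L != 0.
  apply: contraTneq (proj1 b1B : b1 \in unitmx) => D0.
  by rewrite -L0 unitmxE unitfE -detL D0 horner0 eqxx.
have [s] : exists s, (\det L * (P1 * P2)).[s] != 0.
  by apply: poly_nonroot; rewrite !mulf_neq0.
rewrite !hornerM !mulf_eq0 !negb_or => /and3P[Ds P1s P2s].
have : schubert F d w (lcosetQ d (map_mx (horner_eval s) M)).
  apply: cell_sub_schubert; exists (map_mx (horner_eval s) L); first exact: LB.
  by rewrite ME LE.
by case/sub; [apply: H1|apply: H2].
Qed.

End SchubertVarietiesByRanks.

(** * Levi stability and codimension one *)

Section LeviStability.
Variables (F : numFieldType) (n d : nat) (I : set nat).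
Hypothesis simpleI : I `<=` simple_roots n.
Implicit Types (g h : 'M[F]_n) (v w : 'S_n).

Lemma parabolic_tail g i : parabolic I g -> ~ I i ->
  mask (tail i) *m g = mask (tail i) *m g *m mask (tail i).
Proof.
move=> [_ gI] nIi; apply/matrixP => p q; rewrite mul_maskE mask_mulE /tail.
case: ifP => // ip; case: leqP => // qi; apply: gI; first exact: leq_trans ip.
move=> /(_ i); rewrite (minn_idPr _) ?(maxn_idPl _) ?qi ?ip; first by move=> /(_ isT).
all: exact: leq_trans (ltnW qi) ip.
Qed.

Lemma tperm_levi (x y : 'I_n) : y.+1 = x :> nat -> I x -> levi F n I (perm_mx (tperm y x)).
Proof.
move=> yx Ix; have tI : parabolic I (perm_mx (tperm y x) : 'M[F]_n).
  split; first by rewrite /GL /= unitmx_perm.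
  move=> p q qp nspan; rewrite !mxE; case: eqP => // pq; case: nspan => k.
  rewrite (minn_idPr (ltnW qp)) (maxn_idPl (ltnW qp)) => kqp.
  suff -> : k = x by [].
  by move: pq qp kqp; case: tpermP => [->|->|_ _] <-; lia.
by split=> //; rewrite tr_perm_mx tpermV.
Qed.

(** If y is an entry and x is not, the transposition of y and x, an element of the Levi, breaks the
    rank condition at x. Conversely, rank conditions outside I are preserved by the parabolic, and
    those at I follow from them. *)
Lemma stable_levi v : stable (levi F n I) (schubert F d v) <->
  forall x y : 'I_n, y.+1 = x :> nat -> I x ->
    head d (v^-1 y)%g -> head d (v^-1 x)%g.
Proof.
split=> [st x y yx Ix hy|H].
  apply: contrapT => /negP hx; pose t := tperm y x.
  have vU : GL (perm_mx v^-1 : 'M[F]_n) by rewrite /GL /= unitmx_perm.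
  have Xv : schubert F d v (lcosetQ d (perm_mx v^-1)).
    by apply: cell_sub_schubert; exists 1%:M; [exact: borel1|rewrite mul1mx].
  have := st _ _ (tperm_levi yx Ix) Xv; rewrite lcosetQ_image -perm_mxM.
  have -> : (tperm y x * v^-1 = (v * t)^-1)%g by rewrite invMg tpermV.
  rewrite schubertE => /rank_varietyP; rewrite /GL /= unitmx_perm => /(_ isT)/(_ x).
  rewrite schubert_rank_perm (perm_rank_exchange x yx); last 2 first.
  - by rewrite invMg permM tpermV tpermR.
  - by rewrite invMg permM tpermV tpermL.
  by rewrite -mulgA tperm2 mulg1 eqxx ltnn.
move=> g c gI; rewrite schubertE => -[h [hU hv] <-]; rewrite lcosetQ_image.
have [gP _] := gI; have gU := proj1 gP.
apply/rank_varietyP; first by rewrite /GL /= unitmx_mul [g \in _]gU.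
have base i : ~ I i -> (schubert_rank d i (g *m h) <= perm_rank d i v)%N.
  by move=> nIi; apply: leq_trans (hv i); apply/schubert_rank_stable/parabolic_tail.
(* At a root of I the rank condition follows from the one at i - 1 or i + 1. *)
have down i : ~ I i \/ (exists2 y : 'I_n, y.+1 = i & ~~ head d (v^-1 y)%g) ->
    (schubert_rank d i (g *m h) <= perm_rank d i v)%N.
  elim: i => [|i IH] Hi; first by apply: base => /simpleI.
  have [/base//|] := pselect (~ I i.+1); case: Hi => // -[y [yi] hy] _.
  have /andP[le _] := tail_rank_leS (g *m h *m mask (head d)) i; apply: leq_trans le _.
  have := perm_rank_step d v y; rewrite yi (negbTE hy) ; rewrite add0n => <-; apply: IH.
  (* By [H], absence of y from the entries passes to its predecessor as long as the roots stay in
     I. *)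
  have [Iy|] := pselect (I i); last by left.
  have /andP[i0 i_n] := simpleI Iy; right.
  have zn : (i.-1 < n)%N by lia.
  exists (Ordinal zn); first by rewrite /= prednK.
  by apply: contra hy; apply: H; rewrite /= yi ?prednK.
have up i : ~ I i \/ (exists2 x : 'I_n, x = i :> nat & head d (v^-1 x)%g) ->
    (schubert_rank d i (g *m h) <= perm_rank d i v)%N.
  have [N] := ubnP (n - i)%N; elim: N i => // N IH i; rewrite ltnS => iN Hi.
  have [/base//|] := pselect (~ I i); case: Hi => // -[x xi hx] /contrapT Ii.
  have /andP[_ le] := tail_rank_leS (g *m h *m mask (head d)) i; apply: leq_trans le _.
  have := perm_rank_step d v x; rewrite hx xi => ->; rewrite add1n ltnS.
  have lin := ltn_ord x; apply: IH; first by lia.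
  have [Ix|] := pselect (I i.+1); last by left.
  have /andP[_ i_n] := simpleI Ix; right; exists (Ordinal i_n) => //.
  by apply: H hx; rewrite /= ?xi.
move=> i; have [Ii|/base//] := pselect (I i).
have /andP[i0 i_n] := simpleI Ii; have zn : (i.-1 < n)%N by lia.
have [hz|hz] := boolP (head d (v^-1 (Ordinal zn))%g).
  apply: up; right; exists (Ordinal i_n) => //.
  by apply: H hz; rewrite //= prednK.
by apply: down; right; exists (Ordinal zn) => //; rewrite /= prednK.
Qed.

End LeviStability.

(** * Nothing irreducible strictly between X_w and an exchanged variety *)

Section CodimensionOne.
Variables (F : numFieldType) (n d : nat) (w : 'S_n) (x y : 'I_n).
Hypotheses (yx : y.+1 = x :> nat) (hx : head d (w^-1 x)%g) (hy : ~~ head d (w^-1 y)%g).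
Implicit Types (g : 'M[F]_n) (Z : set (set 'M[F]_n)).

Let w' := (w * tperm y x)%g.
Let delta g := minor d w' g.
Let tau g := minor d w g.

Lemma exchange_neq : x != y.
Proof. by rewrite -val_eqE /= -yx; lia. Qed.

Lemma exchange_invx : ~~ head d (w'^-1 x)%g.
Proof. by rewrite invMg permM tpermV tpermR. Qed.

Lemma schubert_exchange_sub : schubert F d w' `<=` schubert F d w.
Proof.
apply: schubert_min; first exact: schubert_closed.
by apply: schubert_cell_exchange => //; [exact: schubert_closed|exact: cell_sub_schubert].
Qed.

Lemma perm_in_schubert (v : 'S_n) : schubert F d v (lcosetQ d (perm_mx v^-1)).
Proof. by apply: cell_sub_schubert; exists 1%:M; [exact: borel1|rewrite mul1mx]. Qed.

Lemma schubert_exchange_neq : schubert F d w' <> schubert F d w.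
Proof.
move=> eqX; have := @perm_in_schubert w; rewrite -eqX schubertE => /rank_varietyP.
rewrite /GL /= unitmx_perm => /(_ isT)/(_ x).
by rewrite schubert_rank_perm (perm_rank_exchange x yx hx hy) eqxx ltnn.
Qed.

(** The ranks of g lie between those of w' and w, which differ only at x. If the rank at x were that
    of w, all ranks would agree with w and tau would not vanish. *)
Lemma schubert_exchange_tau g : GL g -> schubert F d w (lcosetQ d g) ->
  delta g != 0 -> tau g = 0 -> schubert F d w' (lcosetQ d g).
Proof.
move=> gU; rewrite !schubertE => /(rank_varietyP _ _ gU) gw /minor_neq0_rank dg tg.
apply/rank_varietyP => // i; have := gw i; rewrite (perm_rank_exchange i yx hx hy).
have [->|//] := eqVneq (i : nat) x; rewrite add1n leq_eqVlt ltnS => /orP[/eqP gx|//].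
suff : tau g != 0 by rewrite tg eqxx.
apply: rank_minor_neq0 => // k; rewrite (perm_rank_exchange k yx hx hy).
have [->|kx] := eqVneq k x; first by rewrite gx add1n.
apply/eqP; rewrite add0n eqn_leq dg andbT.
by have := gw k; rewrite (perm_rank_exchange k yx hx hy) (negbTE kx).
Qed.

(* The value y is missing from the first d entries of w, so that the rank
   condition at x follows from the one at y. *)
Lemma schubert_shear s g : GL g -> schubert F d w (lcosetQ d g) ->
  schubert F d w (lcosetQ d (shear x y s *m g)).
Proof.
move=> gU; rewrite schubertE => /(rank_varietyP _ _ gU) gw.
apply/rank_varietyP.
  by rewrite /GL /= unitmx_mul shear_unit ?exchange_neq // [g \in _]gU.
have other (i : nat) : i != x ->
    (schubert_rank d i (shear x y s *m g) <= perm_rank d i w)%N.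
  move=> ix; apply: leq_trans (gw i); apply: schubert_rank_stable.
  apply/matrixP => p q; rewrite mul_maskE mask_mulE /tail.
  case: ifP => // ip; case: leqP => // qi; rewrite shearE -!val_eqE /=.
  rewrite gtn_eqF ?(leq_trans qi) //.
  case: eqP => [px|_]; case: eqP => [qy|_]; rewrite ?mulr0 ?addr0 //.
  by exfalso; move: ix ip qi; rewrite px qy -yx; lia.
move=> i; have [->|/other//] := eqVneq i x.
have := perm_rank_step d w y; rewrite yx (negbTE hy) add0n => <-.
apply: leq_trans (other y _); last by rewrite -yx; lia.
have /andP[le _] := tail_rank_leS (shear x y s *m g *m mask (head d)) y.
by rewrite /schubert_rank -yx.
Qed.

Lemma schubert_between Z : irreducible_closed d Z ->
  schubert F d w' `<=` Z -> Z `<=` schubert F d w ->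
  Z = schubert F d w' \/ Z = schubert F d w.
Proof.
move=> [Zc _ Zirr] w'Z Zw.
have [wZ|nwZ] := pselect (schubert F d w `<=` Z); first by right; apply/seteqP.
left; apply/seteqP; split=> //.
have [ZG [S SZ]] := proj1 (GLmodQ_closedP _ _) Zc.
have minor_poly v : exists p : {mpoly F[n * n]}, forall g, peval_at g p = minor d v g.
  by exists (minor d v (@generic_mx F n)) => g; rewrite map_minor map_generic_mx.
have [[dp dpE] [tp tpE]] := (minor_poly w', minor_poly w).
have cosetE g g' : GL g -> lcosetQ d g g' -> GL g' /\ lcosetQ d g' = lcosetQ d g.
  by move=> gU [q Qq <-]; rewrite lcosetQM // /GL /= unitmx_mul [g \in _]gU (proj1 Qq).
(* Otherwise X_w is covered by Z and the zeros of delta. By irreducibility it lies in one of them,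
   but it is not in Z, and delta is 1 at the permutation matrix of w'. *)
have [g2 [g2U g2w dg2 g2Z]] : exists g, [/\ GL g, schubert F d w (lcosetQ d g),
    delta g != 0 & ~ Z (lcosetQ d g)].
  have [_ _ /(_ Z _ Zc (GLmodQ_closed_peval d dp)) irr] := schubert_irreducible F d w.
  apply: contrapT => /forallNP H.
  have [|//|/(_ _ (schubert_exchange_sub (@perm_in_schubert w')))[_]] := irr.
    move=> c wc; have [cZ|ncZ] := pselect (Z c); [by left|right].
    have [cG _] := conj (proj1 (schubert_closed F d w) _ wc) I; split=> // g cg.
    have [g0 g0U ce] := cG; rewrite -ce in cg; have [gU ge] := cosetE _ _ g0U cg.
    rewrite -peval_atE dpE; have [//|dg] := eqVneq (delta g) 0.
    by case: (H g); split=> //; rewrite ge ce.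
  move=> /(_ _ (lcosetQ_refl _ _)); rewrite -peval_atE dpE minor_perm => /eqP.
  by rewrite oner_eq0.
have [f [Sf fg2]] : exists f, S f /\ peval f g2 != 0.
  apply: contrapT => /forallNP H; apply: g2Z; apply/(SZ _ g2U) => f Sf.
  by have [//|nf] := eqVneq (peval f g2) 0; case: (H f).
(* For fixed g, the polynomial s |-> f (G g s) is unchanged when g is replaced by
   shear x y t *m g, and at s = tau g it is the value of f on the coset of g. *)
pose lam := (delta g2)^-1.
pose G g s : 'M[F]_n := lam *: (delta g *: g + (s - tau g) *: (delta_mx x y *m g)).
pose iota c : {poly {mpoly F[n * n]}} := (c%:MP)%:P.
pose X : 'M[{poly {mpoly F[n * n]}}]_n := map_mx polyC (@generic_mx F n).
pose M := iota lam *: (dp%:P *: X + ('X - tp%:P) *: (delta_mx x y *m X)).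
pose P := psubst iota f M.
have PE g s : (map_poly (peval_at g) P).[s] = peval f (G g s).
  rewrite -peval_at2E (@rmorph_psubst _ _ _ iota (peval_at2 g s)); last first.
    by move=> c; rewrite peval_at2C peval_atC.
  congr (peval f _); rewrite map_shear_family peval_at2_generic peval_at2X !peval_at2C.
  by rewrite tpE dpE peval_atC.
(* At s = tau g only a scalar multiple of g is left, hence the same coset if delta g is not zero;
   [lam] makes the scalar 1 at [g2]. *)
have G_tau g : G g (tau g) = g *m (lam * delta g)%:M.
  by rewrite /G subrr scale0r addr0 scalerA mul_mx_scalar.
pose good g := [/\ GL g, schubert F d w (lcosetQ d g) & delta g != 0].
have : exists k, `[< exists g, good g /\ (map_poly (peval_at g) P)`_k != 0 >].
  apply: contrapT => /forallNP H; move/eqP: fg2; apply.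
  have -> : g2 = G g2 (tau g2) by rewrite G_tau mulVf // mulmx1.
  rewrite -PE; suff -> : map_poly (peval_at g2) P = 0 by rewrite horner0.
  apply/polyP => k; rewrite coef0; apply: contrapT => /eqP nz; apply: (H k).
  by apply/asboolP; exists g2.
case/ex_minnP => K /asboolP[g0 [g0good g0K]] Kmin.
(* f = tau ^ K * h on the good points of X_w, and h is not zero on all of X_w'. *)
pose H := drop_poly K P.
have PH g : good g -> map_poly (peval_at g) P = map_poly (peval_at g) H * 'X^K.
  move=> gg; rewrite -[in LHS](poly_take_drop K P) rmorphD rmorphM /= map_polyXn.
  suff -> : map_poly (peval_at g) (take_poly K P) = 0 by rewrite add0r.
  apply/polyP => k; rewrite coef_map coef_take_poly coef0.
  case: ltnP => kK; last exact: rmorph0.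
  apply: contrapT => /eqP nz; move: kK; rewrite ltnNge Kmin //.
  by apply/asboolP; exists g; split=> //; rewrite coef_map.
(* The factor delta makes the equation hold trivially where delta vanishes. *)
pose hp := dp * H.[tp].
have hpE g : peval hp g = delta g * (map_poly (peval_at g) H).[tau g].
  by rewrite -peval_atE rmorphM -horner_map dpE tpE.
have [] := Zirr _ _ (schubert_closed F d w') (GLmodQ_closed_peval d hp).
- move=> c Zc'; have [cw'|ncw'] := pselect (schubert F d w' c); [by left|right].
  split; first exact: ZG.
  have [g1 g1U ce] := ZG _ Zc'; move=> g; rewrite -ce => /(cosetE _ _ g1U)[gU ge].
  rewrite hpE; have [->|dg] := eqVneq (delta g) 0; first by rewrite mul0r.
  have gZ : Z (lcosetQ d g) by rewrite ge ce.
  have tg : tau g != 0.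
    apply: contra_notN ncw' => /eqP tg; rewrite -ce -ge.
    by apply: schubert_exchange_tau => //; apply: Zw.
  have : (map_poly (peval_at g) P).[tau g] = 0.
    have c0 : lam * delta g != 0 by rewrite mulf_neq0 ?invr_eq0.
    have Qc := @max_parabolicZ F n d _ c0.
    have gcU : GL (g *m (lam * delta g)%:M).
      by rewrite /GL /= unitmx_mul [g \in _]gU (proj1 Qc).
    by rewrite PE G_tau; apply: (proj1 (SZ _ gcU)) Sf; rewrite lcosetQM.
  rewrite (PH g) ?hornerM ?hornerXn; last by split=> //; apply: Zw.
  by move/eqP; rewrite mulf_eq0 expf_eq0 (negbTE tg) andbF orbF => /eqP ->; rewrite mulr0.
- by [].
move=> Zh; exfalso; have [g0U g0w dg0] := g0good.
(* This shear makes tau zero and keeps delta, so it moves [g0] into X_w'. *)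
pose s := - (tau g0 / delta g0); pose g1 := shear x y s *m g0.
have g1U : GL g1 by rewrite /GL /= unitmx_mul shear_unit ?exchange_neq // [g0 \in _]g0U.
have dg1 : delta g1 = delta g0 by apply: minor_shear exchange_invx.
have tg1 : tau g1 = 0.
  by rewrite /tau minor_shear_exchange // -/(tau g0) -/(delta g0) mulNr divfK // subrr.
have g1w' : schubert F d w' (lcosetQ d g1).
  by apply: schubert_exchange_tau => //; [exact: schubert_shear|rewrite dg1].
have [_ /(_ _ (lcosetQ_refl _ _))] := Zh _ (w'Z _ g1w').
rewrite hpE dg1 tg1 => /eqP; rewrite mulf_eq0 (negbTE dg0) /= => /eqP H0.
have GE t : G g1 t = G g0 t.
  rewrite /G dg1 tg1 subr0; congr (_ *: _); apply/matrixP => i j.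
  rewrite mxE [X in X + _]mxE [X in _ + X]mxE [RHS]mxE [X in _ = X + _]mxE.
  rewrite [X in _ = _ + X]mxE !delta_mulE !shear_mulE [y == x]eq_sym.
  rewrite (negbTE exchange_neq) mulr0 mul0r addr0 mulrDr /s.
  case: (i == x); rewrite !(mulr1, mul1r, mul0r, mulr0, addr0) //.
  have -> : delta g0 * (- (tau g0 / delta g0) * g0 y j) = - (tau g0 * g0 y j).
    by rewrite mulrA mulrN mulrCA divff // mulr1 mulNr.
  by rewrite mulrBl -addrA [X in _ + X]addrC.
(* The coefficient of index [K] is thus the same at [g1] as at [g0], where it is nonzero; at [g1] it
   is the constant term of [H], which vanishes by [H0]. *)
have PP : map_poly (peval_at g1) P = map_poly (peval_at g0) P.
  apply/eqP; rewrite -subr_eq0; apply/eqP; apply: contrapT => /eqP/poly_nonroot [u].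
  by rewrite hornerD hornerN !PE GE subrr eqxx.
move: g0K; rewrite -PP.
have -> : map_poly (peval_at g1) P = map_poly (peval_at g1) H * 'X^K.
  by apply: PH; split=> //; [exact: schubert_shear|rewrite dg1].
by rewrite coefMXn ltnn subnn -horner_coef0 H0 eqxx.
Qed.

End CodimensionOne.

(** * Schubert divisors *)

Section Divisors.
Variables (F : numFieldType) (n d : nat).
Implicit Types (v w : 'S_n) (X Z : set (set 'M[F]_n)).

Lemma schubert_subP v w : schubert F d v `<=` schubert F d w <->
  forall i, (perm_rank d i v <= perm_rank d i w)%N.
Proof.
split=> [vw i|vw].
  have := vw _ (@perm_in_schubert F n d v); rewrite schubertE => /rank_varietyP.
  by rewrite /GL /= unitmx_perm => /(_ isT)/(_ i); rewrite schubert_rank_perm.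
apply: schubert_min; first exact: schubert_closed.
exact: schubert_cell_closure (@schubert_closed F n d w) (@cell_sub_schubert F n d w) vw.
Qed.

Lemma increasing_chain_sub (T : Type) (c : nat -> set T) m i k :
  (forall i, (i < m)%N -> c i `<` c i.+1) -> (i <= k <= m)%N -> c i `<=` c k.
Proof.
move=> incr; elim: k => [|k IH]; first by rewrite leqn0 => /andP[/eqP -> _] z.
rewrite leq_eqVlt => /andP[/predU1P[->|ik] km]; first by move=> z.
by apply: subset_trans (IH _) (proj1 (incr _ km)); rewrite -ltnS ik ltnW.
Qed.

(** In a chain of length two or more, the second member would lie strictly between the two
    varieties, against [schubert_between]. *)
Lemma schubert_exchange_codim w (x y : 'I_n) :
  y.+1 = x :> nat -> head d (w^-1 x)%g -> ~~ head d (w^-1 y)%g ->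
  has_codim d (schubert F d (w * tperm y x)%g) (schubert F d w) 1.
Proof.
move=> yx hx hy.
have sub := @schubert_exchange_sub F n d w x y yx hx hy.
have neq := @schubert_exchange_neq F n d w x y yx hx hy.
split=> [|m [c [c0 cm cirr cincr]]].
  exists (fun i => if i is 0 then schubert F d (w * tperm y x)%g else schubert F d w).
  split=> // [[|i] _|[|//] _]; try exact: schubert_irreducible.
  by split=> // wsub; apply: neq; apply/seteqP.
rewrite leqNgt; apply/negP => m2.
have [c01 n10] := cincr 0%N (ltnW m2); have [c12 n21] := cincr 1%N m2.
have c2w : c 2 `<=` schubert F d w.
  by apply: subset_trans cm; apply: (increasing_chain_sub cincr); rewrite m2 leqnn.
have c1w : c 1%N `<=` schubert F d w by apply: subset_trans c2w.
rewrite c0 in c01 n10.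
case: (schubert_between yx hx hy (cirr _ (ltnW m2)) c01 c1w) => ce.
  by apply: n10; rewrite ce.
by apply: n21; rewrite ce.
Qed.

(** Some exchanged variety contains X_v; if it were larger, inserting it would give a chain of
    length two up to X_w. *)
Lemma divisor_exchange w v : schubert F d v `<=` schubert F d w ->
  has_codim d (schubert F d v) (schubert F d w) 1 ->
  exists x y : 'I_n, [/\ y.+1 = x :> nat, head d (w^-1 x)%g, ~~ head d (w^-1 y)%g &
    schubert F d v = schubert F d (w * tperm y x)%g].
Proof.
move=> vw [[c [c0 c1w _ cincr]] maxm]; have vwr := proj1 (schubert_subP v w) vw.
have ex : exists i, perm_rank d i v != perm_rank d i w.
  apply: contrapT => /forallNP same; have [_] := cincr 0%N isT; rewrite c0; apply.
  apply: subset_trans c1w _; apply/schubert_subP => i.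
  by rewrite leq_eqVlt; apply/orP; left; rewrite eq_sym; apply/negPn/negP/same.
have [x [y [yx hx hy vt]]] := perm_rank_exists_exchange vwr ex.
exists x, y; split=> //; apply: contrapT => neq.
suff /maxm : irreducible_chain d (schubert F d v) (schubert F d w) 2 by [].
exists (fun i => if i is i'.+1 then if i' is 0 then schubert F d (w * tperm y x)%g
                 else schubert F d w else schubert F d v).
split=> // [[|[|i]] _|[|[|//]] _]; try exact: schubert_irreducible.
  have sub := proj2 (schubert_subP v (w * tperm y x)%g) vt.
  by split=> // vsub; apply: neq; apply/seteqP.
split; first exact: schubert_exchange_sub.
move=> wsub; apply: (@schubert_exchange_neq F n d w x y yx hx hy).
by apply/seteqP; split=> //; apply: schubert_exchange_sub.
Qed.

End Divisors.

(** * Passage to one-line notation *)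

Section OneLineNotation.
Variables (n d : nat) (w : 'S_n).

Lemma mem_take_one_line (k : 'I_n) : (k.+1 \in take d (one_line w)) = head d (w^-1 k)%g.
Proof.
have f_inj : injective (fun i => (w i).+1) by move=> i i' [] /val_inj/perm_inj.
have -> : k.+1 = (fun i => (w i).+1) ((w^-1)%g k) by rewrite /= permKV.
rewrite -map_take (mem_map f_inj).
by rewrite in_take ?mem_enum // index_enum_ord.
Qed.

Lemma exchange_belowE (x y : 'I_n) : y.+1 = x :> nat ->
  exchange_below w x.+1 = (w * tperm y x)%g.
Proof.
move=> yx; rewrite /exchange_below /= -{1}yx /=.
by rewrite !valK.
Qed.

(** The values y and x are adjacent and sit on different sides of position d, so the order inside
    each side is unchanged. *)
Lemma grassmann_exchange (x y : 'I_n) : y.+1 = x :> nat ->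
  head d (w^-1 x)%g -> ~~ head d (w^-1 y)%g ->
  grassmann_perm d w -> grassmann_perm d (w * tperm y x)%g.
Proof.
move=> yx hx hy gw p q pq pqd; have := gw p q pq pqd; rewrite !permM.
have wx r : w r = x :> nat -> (r < d)%N.
  by move/val_inj => wr; move: hx; rewrite -wr permK.
have wy r : w r = y :> nat -> (d <= r)%N.
  by move/val_inj => wr; move: hy; rewrite -wr permK -leqNgt.
have neq (i k : 'I_n) : i <> k -> i <> k :> nat by move=> ik /val_inj.
have [[[wxp wyp] wxq] wyq] := (wx p, wy p, wx q, wy q).
case: tpermP => [/(congr1 val)/= p1|/(congr1 val)/= p1|/neq p1 /neq p2];
  case: tpermP => [/(congr1 val)/= q1|/(congr1 val)/= q1|/neq q1 /neq q2]; lia.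
Qed.

End OneLineNotation.

Theorem theorem6p5 (R : realType) (n d : nat) (hd : (0 < d < n)%N)
    (I : set nat) (hI : I `<=` simple_roots n)
    (w : 'S_n) (hw : grassmann_perm d w) (hw1 : w <> 1%g)
    (j : nat) (a b : nat -> nat)
    (hab : take d (one_line w)
           = flatten [seq iota (a l) (b l).+1 | l <- iota 1 j])
    (hgap : forall l, (1 <= l < j)%N -> (a l + b l + 1 < a l.+1)%N)
    (hL : stable (levi R[i] n I) (schubert R[i] d w)) :
  (forall D : set (set 'M[R[i]]_n), schubert_divisor d w D ->
     exists l, [/\ (1 <= l <= j)%N, (1 < a l)%N &
       D = schubert R[i] d (exchange_below w (a l))]) /\
  (forall l, (1 <= l <= j)%N -> (1 < a l)%N ->
     let wl := exchange_below w (a l) in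
     [/\ schubert_divisor d w (schubert R[i] d wl),
         stable (levi R[i] n I) (schubert R[i] d wl)
           <-> degree1_head R[i] d I w wl &
         stable (levi R[i] n I) (schubert R[i] d wl)
           <-> (simple_roots n `\` I) (a l - 1)%N]).
Proof.
have mem_blocks k : reflect (exists2 l, (1 <= l <= j)%N & (a l <= k <= a l + b l)%N)
    (k \in take d (one_line w)).
  rewrite hab; apply: (iffP flatten_mapP) => -[l].
    by rewrite mem_iota mem_iota => lj kl; exists l; lia.
  by move=> lj kl; exists l; rewrite mem_iota; lia.
have a_incr l m : (1 <= l)%N -> (l < m <= j)%N -> (a l + b l + 1 < a m)%N.
  move=> l1; elim: m => // m IH /andP[]; rewrite ltnS leq_eqVlt => /predU1P[<-|lm] mj.
    by apply: hgap; lia.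
  by have := hgap m; have := IH; lia.
split=> [_ [v [vG -> vw vcodim]]|l lj al wl].
  have [x [y [yx hx hy ->]]] := divisor_exchange vw vcodim.
  have /mem_blocks[l lj xl] : x.+1 \in take d (one_line w) by rewrite mem_take_one_line.
  (* If x + 1 were not the start of its block, the preceding value y + 1 would be in the block
     too. *)
  have ax : a l = x.+1.
    apply/eqP; rewrite eqn_leq (proj1 (andP xl)) leqNgt; apply: contra hy => lt.
    by rewrite -mem_take_one_line; apply/mem_blocks; exists l => //; lia.
  exists l; split; [exact: lj|by rewrite ax ltnS -yx|].
  by rewrite ax (exchange_belowE _ yx).
have aw : a l \in take d (one_line w) by apply/mem_blocks; exists l => //; lia.
have [x ax] : exists x : 'I_n, a l = x.+1.
  have /mem_take /mapP[p _ ->] := aw.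
  by exists (w p).
have yn : ((a l).-2 < n)%N by have := ltn_ord x; lia.
pose y := Ordinal yn; have yx : y.+1 = x :> nat by rewrite /=; lia.
have hx : head d (w^-1 x)%g by rewrite -mem_take_one_line -ax.
(* The gap hypothesis keeps a_l - 1 out of every other block, and it precedes its own. *)
have hy : ~~ head d (w^-1 y)%g.
  rewrite -mem_take_one_line; apply/mem_blocks => -[m mj ym].
  have := a_incr m l; have := a_incr l m.
  have : y.+1 = (a l).-1 by rewrite /=; lia.
  have [->|] := eqVneq l m; lia.
have wlE : wl = (w * tperm y x)%g by rewrite /wl ax (exchange_belowE _ yx).
have wlG : grassmann_perm d wl by rewrite wlE; apply: grassmann_exchange.
have wlw : schubert R[i] d wl `<=` schubert R[i] d w.
  by rewrite wlE; apply: schubert_exchange_sub.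
split.
- by exists wl; split=> //; rewrite wlE; apply: schubert_exchange_codim.
- by split=> [//|[]].
(* In 1-based terms a_l - 1 is the simple root separating the indices y and x. *)
have a1x : (a l - 1)%N = x by rewrite ax subn1.
have stP := @stable_levi R[i] n d I hI.
rewrite a1x; apply: iff_trans (stP wl) _; rewrite wlE.
have inv k : ((w * tperm y x)^-1 k = w^-1 (tperm y x k))%g by rewrite invMg permM tpermV.
split=> [st|[_ nIx] x' y' yx' Ix'].
  split; first by rewrite /simple_roots /= ltn_ord -yx.
  move=> Ix; have := st x y yx Ix; rewrite !inv tpermL tpermR hx => /(_ isT).
  exact/negP.
(* The condition is inherited from w, except at pairs meeting {y, x}: with y' = x its premise fails,
   since x is no longer an entry, and with x' = y its conclusion holds, since y has become one. *)
rewrite !inv; have hL' := proj1 (stP w) hL x' y' yx' Ix'.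
have x'x : x' != x by apply: contra_notN nIx => /eqP <-.
have [->|y'x] := eqVneq y' x; first by rewrite tpermR (negbTE hy).
have [->|x'y] := eqVneq x' y; first by rewrite tpermL hx.
have y'y : y' != y.
  by apply: contraNneq x'x => y'y; apply/eqP/val_inj; rewrite /= -yx' y'y.
by rewrite !tpermD // eq_sym.
Qed.
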